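(* Let $\psi\in(\mathfrak h[t])^*$ and assume there exist $\mu_1,\dots,\mu_s\in P^+$ and pairwise distinct $z_1,\dots,z_s\in\mathbb C$ such that $\psi(h\otimes t^p)=\sum_{i=1}^s z_i^p\mu_i(h)$ for all $h\in\mathfrak h$, $p\ge0$. Let $n=\psi(h_2)$. Then the vectors $v_{\mathfrak P^s}\,w_\psi$, as $\mathfrak P^s$ ranges over all super POPs for $n$, form a basis of $W(\psi)$.
   Context: $\mathfrak g=\mathfrak{sl}(1|2)$ ($3\times3$ complex supertrace-zero matrices, superbracket $[A,B]=AB-(-1)^{|A||B|}BA$), with $x_1=E_{12},x_2=E_{23},x_3=E_{13},y_1=E_{21},y_2=E_{32},y_3=E_{31}$ ($x_2,y_2$ even, the others odd), $h_1=E_{11}+E_{22}$, $h_2=E_{22}-E_{33}$, $\mathfrak h=\operatorname{span}\{h_1,h_2\}$, $\mathfrak n^+=\operatorname{span}\{y_1,x_2,x_3\}$; $P^+=\{\lambda\in\mathfrak h^*:\lambda(h_2)\in\mathbb Z_{>0}\}\cup\{0\}$; $\mathfrak g[t]=\mathfrak g\otimes\mathbb C[t]$ with $[a\otimes t^r,b\otimes t^s]=[a,b]\otimes t^{r+s}$. For $\psi\in(\mathfrak h[t])^*$ with $\psi(h_2)\in\mathbb Z_+$, $W(\psi)$ is the $\mathfrak g[t]$-module generated by an even vector $w_\psi$ with relations $\mathfrak n^+[t]w_\psi=0$, $xw_\psi=\psi(x)w_\psi$ ($x\in\mathfrak h[t]$), $(y_2\otimes1)^{\psi(h_2)+1}w_\psi=0$.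 POPs: for integers $n_1\ge n_2\ge 0$, a POP with bounding sequence $n_1\ge n_2$ is a pair $\mathfrak P=(m;\underline\pi)$ where $m$ is an integer with $n_1\ge m\ge n_2$ (the Gelfand–Tsetlin pattern with top row $n_1,n_2$ and middle entry $m$) and $\underline\pi$ is a partition with at most $n_1-m$ parts, each part at most $m-n_2$. Let $\underline\pi(k)$ be the number of parts equal to $k$ ($1\le k\le m-n_2$) and $\underline\pi(0)=n_1-m-\sum_{k\ge1}\underline\pi(k)$; set $\rho_{\mathfrak P}=(y_2\otimes1)^{\underline\pi(0)}(y_2\otimes t)^{\underline\pi(1)}\cdots(y_2\otimes t^{m-n_2})^{\underline\pi(m-n_2)}\in U(\mathfrak g[t])$. Super POPs: let $\mathcal S_n$ be the set of $2\times n$ matrices $A=(a_{ij})$ with entries in $\{0,1\}$ such that $a_{1k}=0$ for all $k>n-\sum_{j=1}^n a_{2j}$; let $s(A)=\sum_{i,j}a_{ij}$ and $x_A=\prod_{j=1}^{n}(x_1\otimes t^{j-1})^{a_{1j}}\prod_{j=1}^{n}(y_3\otimes t^{j-1})^{a_{2j}}$ (factors in increasing order of $j$). A super POP for $n$ is a pair $\mathfrak P^s=(A,\mathfrak P_A)$ with $A\in\mathcal S_n$ and $\mathfrak P_A$ a POP with bounding sequence $n-s(A)\ge0$; its monomial is $v_{\mathfrak P^s}=\rho_{\mathfrak P_A}\,x_A\in U(\mathfrak g[t])$. *)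

(* Defs.v *)
From mathcomp Require Import all_boot all_algebra complex.
From mathcomp Require Export reals.
Set Implicit Arguments.
Unset Strict Implicit.
Unset Printing Implicit Defensive.
Import GRing.Theory Num.Theory.
Local Open Scope ring_scope.

Section SL12.
Variable K : fieldType.
Local Notation mx3 := 'M[K]_3.

Definition o1 : 'I_3 := @Ordinal 3 0 isT.
Definition o2 : 'I_3 := @Ordinal 3 1 isT.
Definition o3 : 'I_3 := @Ordinal 3 2 isT.

Definition x1 : mx3 := delta_mx o1 o2.
Definition x2 : mx3 := delta_mx o2 o3.
Definition x3 : mx3 := delta_mx o1 o3.
Definition y1 : mx3 := delta_mx o2 o1.
Definition y2 : mx3 := delta_mx o3 o2.
Definition y3 : mx3 := delta_mx o3 o1.
Definition h1 : mx3 := delta_mx o1 o1 + delta_mx o2 o2.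
Definition h2 : mx3 := delta_mx o2 o2 - delta_mx o3 o3.

(* parity of an index of the super space C^{1|2}: index 1 even, 2,3 odd *)
Definition ipar (i : 'I_3) : bool := i != o1.

(* g = sl(1|2): supertrace-zero 3x3 matrices *)
Definition in_g (A : mx3) : bool := A o1 o1 - A o2 o2 - A o3 o3 == 0.

(* A is homogeneous of parity p (E_ij has parity ipar i + ipar j) *)
Definition homog (p : bool) (A : mx3) : Prop :=
  forall i j, (ipar i (+) ipar j) != p -> A i j = 0.

Definition sgn (p q : bool) : K := (-1) ^+ (p && q).

(* superbracket of homogeneous A (parity p) and B (parity q) *)
Definition sbr (p q : bool) (A B : mx3) : mx3 := A *m B - sgn p q *: (B *m A).

(* A (left) module over U(g[t]) on the K-vector space M, given by the action
   act r A of A (x) t^r, for A in g.  Equivalently: a representation of the Lie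
   superalgebra g[t] with [A(x)t^r, B(x)t^s] = [A,B](x)t^(r+s). *)
Definition is_gt_module (M : lmodType K) (act : nat -> mx3 -> M -> M) : Prop :=
  [/\ forall r A (c : K) (u v : M), act r A (c *: u + v) = c *: act r A u + act r A v,
      forall r (c : K) A B (u : M), in_g A -> in_g B ->
        act r (c *: A + B) u = c *: act r A u + act r B u &
      forall r s p q A B (u : M), in_g A -> in_g B -> homog p A -> homog q B ->
        act r A (act s B u) - sgn p q *: act s B (act r A u) = act (r + s)%N (sbr p q A B) u ].

(* psi in (h[t])^* is given by its values on the basis: psi k r = psi(h_{k+1} (x) t^r) *)
Definition k1 : 'I_2 := @Ordinal 2 0 isT.
Definition k2 : 'I_2 := @Ordinal 2 1 isT.
Definition hb (k : 'I_2) : mx3 := if k == k1 then h1 else h2.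

(* defining relations of W(psi) on the vector w, with n = psi(h2) *)
Definition W_rel (psi : 'I_2 -> nat -> K) (n : nat) (M : lmodType K)
    (act : nat -> mx3 -> M -> M) (w : M) : Prop :=
  [/\ forall r, act r y1 w = 0, forall r, act r x2 w = 0, forall r, act r x3 w = 0,
      forall (k : 'I_2) r, act r (hb k) w = psi k r *: w &
      iter n.+1 (act 0%N y2) w = 0 ].

Inductive generated (M : lmodType K) (act : nat -> mx3 -> M -> M) (w : M) : M -> Prop :=
| gen_w : generated act w w
| gen_add u v : generated act w u -> generated act w v -> generated act w (u + v)
| gen_scale (c : K) u : generated act w u -> generated act w (c *: u)
| gen_act r A u : in_g A -> generated act w u -> generated act w (act r A u).

Definition is_gt_hom (M N : lmodType K) (actM : nat -> mx3 -> M -> M)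
    (actN : nat -> mx3 -> N -> N) (f : M -> N) : Prop :=
  (forall (c : K) u v, f (c *: u + v) = c *: f u + f v) /\
  (forall r A u, in_g A -> f (actM r A u) = actN r A (f u)).

(* (M, act, w) is W(psi): the g[t]-module generated by w subject to the defining
   relations, characterised by its universal property (cyclic on w, and every
   module with a vector satisfying the relations receives a module map sending
   w to that vector). *)
Definition is_W (psi : 'I_2 -> nat -> K) (n : nat) (M : lmodType K)
    (act : nat -> mx3 -> M -> M) (w : M) : Prop :=
  [/\ is_gt_module act, W_rel psi n act w, (forall u, generated act w u) &
      forall (N : lmodType K) (actN : nat -> mx3 -> N -> N) (wN : N),
        is_gt_module actN -> W_rel psi n actN wN ->
        exists f : M -> N, is_gt_hom act actN f /\ f w = wN ].

(* P^+ (weights given by values on h1, h2) *)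
Definition in_Pplus (lam : 'I_2 -> K) : Prop :=
  (exists k : nat, (0 < k)%N /\ lam k2 = k%:R) \/ (lam k1 = 0 /\ lam k2 = 0).

(* action of a monomial (A_1(x)t^r_1) ... (A_k(x)t^r_k), written left to right *)
Definition act_word (M : lmodType K) (act : nat -> mx3 -> M -> M)
    (ws : seq (mx3 * nat)) (u : M) : M :=
  foldr (fun a v => act a.2 a.1 v) u ws.

(* POP with bounding sequence n1 >= n2: middle entry m and partition pi
   (nonincreasing list of positive parts) *)
Definition isPOP (n1 n2 m : nat) (pi : seq nat) : bool :=
  [&& (n2 <= m <= n1)%N, (size pi <= n1 - m)%N,
      all (fun k => (0 < k <= m - n2)%N) pi & sorted geq pi].

Definition rhoPOP (n1 n2 m : nat) (pi : seq nat) : seq (mx3 * nat) :=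
  nseq (n1 - m - size pi)%N (y2, 0%N) ++
  flatten [seq nseq (count_mem k pi) (y2, k) | k <- iota 1 (m - n2)].

(* super POPs for n: the matrix A (entries 0/1 as bool; A 0 j = a_{1,j+1}) *)
Definition sA2 n (A : 'M[bool]_(2, n)) : nat := (\sum_(j < n) A (@Ordinal 2 1 isT) j)%N.
Definition sA n (A : 'M[bool]_(2, n)) : nat := (\sum_(i < 2) \sum_(j < n) A i j)%N.
Definition in_S n (A : 'M[bool]_(2, n)) : bool :=
  [forall j : 'I_n, (n - sA2 A < j.+1)%N ==> ~~ A (@Ordinal 2 0 isT) j].
Definition xA n (A : 'M[bool]_(2, n)) : seq (mx3 * nat) :=
  [seq (x1, val j) | j <- enum 'I_n & A (@Ordinal 2 0 isT) j] ++
  [seq (y3, val j) | j <- enum 'I_n & A (@Ordinal 2 1 isT) j].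

Definition superPOP n (P : 'M[bool]_(2, n) * (nat * seq nat)) : bool :=
  [&& in_S P.1, (sA P.1 <= n)%N & isPOP (n - sA P.1) 0 P.2.1 P.2.2].

Definition superPOP_vec n (M : lmodType K) (act : nat -> mx3 -> M -> M) (w : M)
    (P : 'M[bool]_(2, n) * (nat * seq nat)) : M :=
  act_word act (rhoPOP (n - sA P.1) 0 P.2.1 P.2.2 ++ xA P.1) w.

End SL12.

Definition is_basis_family (K : fieldType) (M : lmodType K) (I : eqType)
    (P : pred I) (v : I -> M) : Prop :=
  (forall u : M, exists (ps : seq I) (c : I -> K),
      all P ps /\ u = \sum_(p <- ps) c p *: v p) /\
  (forall (ps : seq I) (c : I -> K), uniq ps -> all P ps ->
      \sum_(p <- ps) c p *: v p = 0 -> forall p, p \in ps -> c p = 0).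

(* Main.v *)
From HB Require Import structures.
Require Import Defs.
From mathcomp Require Import all_boot all_algebra complex.
From mathcomp Require Import reals boolp.
From mathcomp.real_closed Require Import mxtens.
From mathcomp Require Import ring zify.
Set Implicit Arguments.
Unset Strict Implicit.
Unset Printing Implicit Defensive.
Import GRing.Theory.
Local Open Scope ring_scope.

(** Spanning.  The Lie algebra spanned by the currents of [x2], [y2], [h2] is sl(2)[t].  Filtering by
    the number of odd factors [x1], [y3], a product of [s] odd factors applied to [w] is a highest
    weight vector of weight [n - s] for it, modulo fewer odd factors.  Acting with [x2 (x) t] on
    [y2^(n-s+1)] shows that the coefficients of [z^d], [d > n - s - k], of the [k]-th power of the
    generating series of the currents [y2 (x) t^r] vanish to leading order; in degree [k] these are
    the complete symmetric functions [h_d] in [k] variables, and modulo the ideal they generate the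
    monomials with exponents at most [n - s - k] span.  Applying [x3] and [y1] to the case [k = 1]
    bounds the exponents of [x1] and [y3].  The argument holds over every commutative Q-algebra.

    Independence.  There are at most [4 ^ n] super POPs.  For [n] distinct points the tensor product
    of [n] four-dimensional evaluation modules is cyclic and satisfies the relations, so by spanning
    the super POP vectors form a basis of it.  Move the points along a line in the parameter ['X]: the
    span over K['X] of these vectors is a free, stable lattice, and its reduction at ['X = 0] is a module
    for the possibly degenerate psi on which the super POP vectors are the standard basis. *)

(** * Submodules *)

(** The obstacle is coincidence of points. At a repeated point the tensor product of the
    four-dimensional modules is no longer cyclic, so linear independence cannot be read off it
    there. It is known only for distinct points and has to be transported to the degenerate ones.
    This is why straightening is done over a commutative ring in which only positive integers need
    be inverted. Over K['X] it shows that every current preserves the span of the super POP vectors,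
    so that its matrix in these vectors has polynomial entries. The square matrix of the super POP
    vectors may become singular at 'X = 0, but its determinant is nonzero at 'X = 1, hence nonzero
    in the domain K['X]. The matrix can therefore be cancelled from identities, though not inverted.
    The polynomial matrices of the currents inherit every bracket relation by cancellation, and
    these, not the vectors, are evaluated at 'X = 0. An upper bound on the number of super POPs is
    enough: a spanning family of at most 4^n vectors in dimension 4^n leaves no room for a
    dependence. *)

Section Submodules.
Variables (A : comUnitRingType) (M : lmodType A).
Implicit Types (S G : M -> Prop).

Definition submod S : Prop :=
  [/\ S 0, forall u v, S u -> S v -> S (u + v) & forall (c : A) u, S u -> S (c *: u)].

Lemma submod0 S : submod S -> S 0. Proof. by case. Qed.
Lemma submodD S u v : submod S -> S u -> S v -> S (u + v).
Proof. by case=> _ + _; apply. Qed.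
Lemma submodZ S c u : submod S -> S u -> S (c *: u).
Proof. by case=> _ _; apply. Qed.
Lemma submodN S u : submod S -> S u -> S (- u).
Proof. by move=> hS hu; rewrite -scaleN1r; apply: submodZ. Qed.
Lemma submodB S u v : submod S -> S u -> S v -> S (u - v).
Proof. by move=> hS hu hv; apply: submodD => //; apply: submodN. Qed.
Lemma submodMn S u m : submod S -> S u -> S (u *+ m).
Proof. by move=> hS hu; rewrite -scaler_nat; apply: submodZ. Qed.
Lemma submod_sum S (I : Type) (r : seq I) (P : pred I) (F : I -> M) :
  submod S -> (forall i, P i -> S (F i)) -> S (\sum_(i <- r | P i) F i).
Proof.
move=> hS hF; elim/big_rec: _ => [|i x Pi Sx]; first exact: submod0.
by apply: submodD => //; apply: hF.
Qed.
Lemma submod_addKr S u v : submod S -> S (u + v) -> S u -> S v.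
Proof. by move=> hS huv hu; rewrite -(addKr u v); apply: submodD => //; apply: submodN. Qed.

Lemma submod_zero : submod (fun u => u = 0).
Proof.
by split=> [//|u v -> ->|c u ->]; rewrite ?addr0 ?scaler0.
Qed.

Lemma submod_preim S (f : {linear M -> M}) : submod S -> submod (fun u => S (f u)).
Proof.
move=> hS; split=> [|u v hu hv|c u hu].
- by rewrite linear0; apply: submod0.
- by rewrite linearD; apply: submodD.
- by rewrite linearZ; apply: submodZ.
Qed.

Inductive lin_span G : M -> Prop :=
| lin_span_base u : G u -> lin_span G u
| lin_span_zero : lin_span G 0
| lin_span_add u v : lin_span G u -> lin_span G v -> lin_span G (u + v)
| lin_span_scale c u : lin_span G u -> lin_span G (c *: u).

Lemma lin_span_submod G : submod (lin_span G).
Proof. by split; [exact: lin_span_zero|exact: lin_span_add|exact: lin_span_scale]. Qed.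

Lemma lin_span_min G S : submod S -> (forall u, G u -> S u) -> forall u, lin_span G u -> S u.
Proof.
move=> hS hG u; elim=> {u}[u /hG //||u v _ hu _ hv|c u _ hu].
- exact: submod0.
- exact: submodD.
- exact: submodZ.
Qed.

(** This says that [A] is an algebra over the rationals. The instances used are a field of
    characteristic 0 and the polynomials over it. *)
Definition invertible_nats := forall m : nat, (m.+1%:R : A) \is a GRing.unit.

Lemma submod_divn S u m : invertible_nats -> submod S -> S (u *+ m.+1) -> S u.
Proof.
move=> hA hS; rewrite -scaler_nat => /(submodZ (m.+1%:R^-1) hS).
by rewrite scalerA mulVr ?scale1r.
Qed.

End Submodules.

(** * Sums over compositions *)

Section CompositionSums.
Variables (A : comUnitRingType) (M : lmodType A).
Implicit Types (f g : seq nat -> M) (r t : seq nat) (s : nat).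

(* [comp_sum f r s] is the sum of [f (r + alpha)] over the compositions [alpha]
   of [s] into [size r] nonnegative parts. *)
Fixpoint comp_sum f r s : M :=
  if r is a :: r' then \sum_(i < s.+1) comp_sum (fun t => f ((a + i)%N :: t)) r' (s - i)
  else if s == 0%N then f [::] else 0.

Lemma eq_comp_sum f g r s :
  (forall t, size t = size r -> f t = g t) -> comp_sum f r s = comp_sum g r s.
Proof.
elim: r f g s => [|a r IH] f g s fg /=; first by rewrite fg.
by apply: eq_bigr => i _; apply: IH => t ht; apply: fg; rewrite /= ht.
Qed.

Lemma comp_sum_linear (h : {linear M -> M}) f r s :
  h (comp_sum f r s) = comp_sum (fun t => h (f t)) r s.
Proof.
elim: r f s => [|a r IH] f s /=; first by case: ifP => // _; rewrite linear0.
by rewrite linear_sum; apply: eq_bigr => i _; rewrite IH.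
Qed.

Lemma comp_sumD f g r s :
  comp_sum (fun t => f t + g t) r s = comp_sum f r s + comp_sum g r s.
Proof.
elim: r f g s => [|a r IH] f g s /=; first by case: ifP => // _; rewrite addr0.
by rewrite -big_split; apply: eq_bigr => i _; rewrite IH.
Qed.

Lemma comp_sum_zero r s : comp_sum (fun=> 0) r s = 0.
Proof.
elim: r s => [|a r IH] s /=; first by case: ifP.
by rewrite big1 // => i _; rewrite IH.
Qed.

Lemma comp_sum_nseq0 f r : comp_sum f r 0 = f r.
Proof.
elim: r f => [|a r IH] f //=.
by rewrite big_ord1 /= IH addn0.
Qed.

Lemma exchange_triangle s (F : nat -> nat -> M) :
  \sum_(i < s.+1) \sum_(j < (s - i).+1) F i j = \sum_(j < s.+1) \sum_(i < (s - j).+1) F i j.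
Proof.
have ext (G : nat -> nat -> M) : \sum_(i < s.+1) \sum_(j < (s - i).+1) G i j =
    \sum_(i < s.+1) \sum_(j < s.+1 | (i + j <= s)%N) G i j.
  apply: eq_bigr => i _.
  rewrite (big_ord_widen_cond s.+1 xpredT (fun j => G i j)); last by rewrite ltnS leq_subr.
  by apply: eq_bigl => j /=; have := ltn_ord i; lia.
rewrite (ext F) (ext (fun i j => F j i)) (exchange_big_dep xpredT) //=.
by apply: eq_bigr => j _; apply: eq_bigl => i; rewrite addnC.
Qed.

Lemma comp_sum_swap f a b r s :
  (forall x y t, f (x :: y :: t) = f (y :: x :: t)) ->
  comp_sum f (a :: b :: r) s = comp_sum f (b :: a :: r) s.
Proof.
move=> hf /=.
rewrite (exchange_triangle s (fun i j => comp_sum (fun t => f ((a + i)%N :: (b + j)%N :: t)) r (s - i - j))).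
apply: eq_bigr => j _; apply: eq_bigr => i _.
by rewrite -!subnDA [(i + j)%N]addnC; apply: eq_comp_sum => t _; rewrite hf.
Qed.

Definition perm_invariant f := forall t t', perm_eq t t' -> f t = f t'.

Lemma perm_invariant_cons f a : perm_invariant f -> perm_invariant (fun t => f (a :: t)).
Proof. by move=> hf t t' htt; apply: hf; rewrite perm_cons. Qed.

Lemma perm_invariant_cat f p : perm_invariant f -> perm_invariant (fun t => f (p ++ t)).
Proof. by move=> hf t t' htt; apply: hf; rewrite perm_cat2l. Qed.

Lemma perm_invariant_swap f x y t : perm_invariant f -> f (x :: y :: t) = f (y :: x :: t).
Proof. by apply; rewrite -[x :: _]/([:: x] ++ [:: y] ++ t) perm_catCA. Qed.

Lemma comp_sum_perm f s : perm_invariant f -> perm_invariant (fun r => comp_sum f r s).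
Proof.
move=> + t t'.
have mid p1 a p2 f' s' : perm_invariant f' ->
    comp_sum f' (p1 ++ a :: p2) s' = comp_sum f' (a :: p1 ++ p2) s'.
  elim: p1 f' s' => [//|b p1 IH] f' s' hf.
  rewrite [RHS]comp_sum_swap; last by move=> x y u; apply: perm_invariant_swap.
  rewrite /=; apply: eq_bigr => i _.
  by rewrite IH //; apply: perm_invariant_cons.
elim: t t' f s => [|a t IH] t' f s hf; first by move/perm_size/esym/size0nil ->.
move=> htt'; have hat: a \in t' by rewrite -(perm_mem htt') mem_head.
case/splitPr: hat htt' => p1 p2 htt'.
rewrite mid //; rewrite perm_sym -cat1s perm_catCA /= perm_cons perm_sym in htt'.
rewrite /=; apply: eq_bigr => i _; apply: IH => //; exact: perm_invariant_cons.
Qed.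

(** Complete symmetric functions are homogeneous, so cutting [f] down to total degree [D] keeps a
    composition sum whole or kills it. *)
Lemma comp_sum_graded f D r s :
  comp_sum (fun t => if sumn t == D then f t else 0) r s =
  if (sumn r + s == D)%N then comp_sum f r s else 0.
Proof.
elim: r f D s => [|a r IH] f D s /=; first by case: s => [|s] /=; rewrite ?if_same.
transitivity (\sum_(i < s.+1) if (a + sumn r + s == D)%N then
    comp_sum (fun t => f ((a + i)%N :: t)) r (s - i) else 0); last first.
  by case: ifP => // _; rewrite big1.
apply: eq_bigr => i _; have hi := ltn_ord i.
case: (leqP (a + i) D) => hD.
  rewrite (@eq_comp_sum _ (fun t => if sumn t == (D - (a + i))%N then f ((a + i)%N :: t) else 0)).
    rewrite IH; congr (if _ then _ else _); lia.
  by move=> t _; congr (if _ then _ else _); lia.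
rewrite (@eq_comp_sum _ (fun=> 0)) => [|t _]; last by case: eqP => //; lia.
by rewrite comp_sum_zero; case: eqP => //; lia.
Qed.

(* Transpose of the derivation [d/dy_0] on monomials in the [y_i], with [f] read as a linear form
   on them. *)
Fixpoint del_zero f r : M :=
  if r is a :: r' then (if a == 0%N then f r' else 0) + del_zero (fun t => f (a :: t)) r'
  else 0.

Lemma eq_del_zero f g r :
  (forall t, (size t).+1 = size r -> f t = g t) -> del_zero f r = del_zero g r.
Proof.
elim: r f g => [//|a r IH] f g fg /=.
rewrite fg //; congr (_ + _); apply: IH => t ht; apply: fg; by rewrite /= ht.
Qed.

Lemma del_zero_sum n (F : 'I_n -> seq nat -> M) r :
  del_zero (fun t => \sum_(i < n) F i t) r = \sum_(i < n) del_zero (F i) r.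
Proof.
elim: r F => [|a r IH] F /=; first by rewrite big1.
rewrite IH; case: ifP => _; first by rewrite -big_split.
by rewrite add0r; apply: eq_bigr => i _; rewrite add0r.
Qed.

(** A position contributes only if its entry and its share of [s] are both 0. In terms of
    polynomials, setting one variable to 0 turns h_s into the h_s of the other variables. *)
Lemma comp_sum_del_zero f r s :
  comp_sum (del_zero f) r s = del_zero (fun t => comp_sum f t s) r.
Proof.
elim: r f s => [|a r IH] f s /=; first by rewrite if_same.
rewrite del_zero_sum; under [X in _ = _ + X]eq_bigr => i _ do rewrite -IH.
transitivity (\sum_(i < s.+1) (comp_sum (fun t => if (a + i)%N == 0%N then f t else 0) r (s - i)
   + comp_sum (del_zero (fun t => f ((a + i)%N :: t))) r (s - i))).
  by apply: eq_bigr => i _; rewrite -comp_sumD; apply: eq_comp_sum.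
rewrite big_split /=; congr (_ + _).
case: a => [|a] /=.
  rewrite big_ord_recl /= subn0 big1 ?addr0 => [|i _]; last by rewrite comp_sum_zero.
  exact: eq_comp_sum.
by rewrite big1 // => i _; rewrite comp_sum_zero.
Qed.

Lemma del_zero_sym f r : perm_invariant f ->
  del_zero f (0%N :: r) = f r *+ (count_mem 0%N r).+1.
Proof.
elim: r f => [|a r IH] f hf; first by rewrite /= addr0.
have IHa := IH (fun t => f (a :: t)) (perm_invariant_cons a hf).
rewrite /= in IHa *; case: eqP => [a0|_] /=.
  move: IHa; rewrite a0 => IHa.
  rewrite [in RHS]add1n mulrS; congr (_ + _).
  rewrite -IHa; congr (_ + _); apply: eq_del_zero => t _; exact: perm_invariant_swap.
rewrite add0r add0n -IHa; congr (_ + _); apply: eq_del_zero => t _; exact: perm_invariant_swap.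
Qed.

Lemma del_zero_pos f r : 0%N \notin r -> del_zero f r = 0.
Proof.
elim: r f => [//|a r IH] f /=; rewrite inE negb_or eq_sym => /andP[/negPf -> h].
by rewrite IH // addr0.
Qed.

Lemma perm_invariant_del_zero f : perm_invariant f -> perm_invariant (del_zero f).
Proof.
move=> hf t t' htt.
case: (boolP (0%N \in t)) => h; last first.
  by rewrite !del_zero_pos // -(perm_mem htt).
have key u : 0%N \in u -> del_zero f u = f (rem 0%N u) *+ (count_mem 0%N u).
  elim: u f hf {t t' htt h} => [//|a u IH] f hf; rewrite inE eq_sym /=.
  case: eqP => [-> _|/= na h].
    by rewrite -(del_zero_sym _ hf).
  by rewrite add0r add0n IH //; apply: perm_invariant_cons.
have h' : 0%N \in t' by rewrite -(perm_mem htt).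
rewrite !key // (permP htt); congr (_ *+ _); apply: hf.
by rewrite -(perm_cons 0%N) (perm_trans _ (perm_trans htt _)) // ?(perm_to_rem h') // perm_sym perm_to_rem.
Qed.

End CompositionSums.

(** * Symmetric monomials modulo the ideal of complete symmetric functions *)

Section BoxReduction.
Variables (A : comUnitRingType) (M : lmodType A).
Hypothesis A_nat : invertible_nats A.
Implicit Types (f : seq nat -> M) (B : M -> Prop) (r t : seq nat) (s k d : nat).

(* [h_s(u_(j+1), ..., u_k) = h_s(u_j, ..., u_k) - u_j h_(s-1)(u_j, ..., u_k)] *)
Lemma comp_sum_drop f p a r s :
  comp_sum (fun t => f (rcons p a ++ t)) r s.+1 =
  comp_sum (fun t => f (p ++ t)) (a :: r) s.+1
  - comp_sum (fun t => f (p ++ t)) (a.+1 :: r) s.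
Proof.
rewrite /= big_ord_recl /= addn0 subn0.
have -> : comp_sum (fun t => f (rcons p a ++ t)) r s.+1 = comp_sum (fun t => f (p ++ a :: t)) r s.+1.
  by apply: eq_comp_sum => t _; rewrite cat_rcons.
rewrite [X in _ - X](_ : _ = \sum_(i < s.+1) comp_sum (fun t => f (p ++ (a + bump 0 i)%N :: t)) r (s.+1 - bump 0 i)); last first.
  by apply: eq_bigr => i _; rewrite /bump /= add1n subSS addSnnS.
by rewrite addrK.
Qed.

(** Here [comp_sum f r s] is read as [f] applied to u^r h_s(u). Each variable moved into [p] costs
    one degree through [comp_sum_drop], hence the bound [d + size p <= s]. *)
Lemma comp_sum_suffix B f k d :
  submod B ->
  (forall r s, size r = k -> (d <= s)%N -> B (comp_sum f r s)) ->
  forall p r s, (size p + size r)%N = k -> (d + size p <= s)%N ->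
    B (comp_sum (fun t => f (p ++ t)) r s).
Proof.
move=> hB h; elim/last_ind => [|p a IH] r s hk hs.
  by apply: h; rewrite // -(addn0 d).
rewrite size_rcons in hk hs; case: s hs => [|s] hs; first by rewrite addnS in hs.
rewrite comp_sum_drop; apply: submodB => //; apply: IH => /=; lia.
Qed.

(* [u_1 ... u_k h_(d-1)] lies in the ideal generated by [h_d, h_(d+1), ...]. *)
Lemma comp_sum_shift B f k d :
  submod B -> (0 < k)%N ->
  (forall r s, size r = k -> (d.+1 <= s)%N -> B (comp_sum f r s)) ->
  forall r, size r = k -> B (comp_sum f (map succn r) d).
Proof.
move=> hB k0 h.
suff key p r : (size p + size r)%N = k ->
    B (comp_sum (fun t => f (p ++ t)) (map succn r) (d + size p)).
  by move=> r hr; have := key [::] r; rewrite addn0 => /(_ hr).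
elim: r p => [|a r IH] p hk.
  (* No variable is left and the degree d + k is positive, so the sum is 0. *)
  rewrite /=; case: eqP => [|_]; last exact: submod0.
  by move: hk k0 => /=; lia.
have e1 : (d + size p)%N.+1 = (d + size (rcons p a))%N by rewrite size_rcons addnS.
have := @comp_sum_drop f p a (map succn r) (d + size p).
move/eqP; rewrite eq_sym subr_eq addrC -subr_eq => /eqP <-.
apply: submodB => //; last by rewrite e1; apply: IH; rewrite size_rcons /= in hk *; lia.
by apply: (comp_sum_suffix hB h); rewrite /= ?size_map // in hk *; lia.
Qed.

(** Induction on [k + d], splitting by multiplication by u_1 ... u_k and restriction to u_k = 0.
    Monomials without exponent 0 are the case (k, d - 1), where [comp_sum_shift] supplies the
    missing relation h_(d-1). Those with an exponent 0 are the case (k - 1, d). The box with k rows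
    and d - 1 columns is that of the Schubert classes of the Grassmannian Gr(k, k + d - 1). *)
Lemma box_reduction B f k d :
  submod B -> perm_invariant f ->
  (forall r, size r = k -> all (fun i => i < d)%N r -> B (f r)) ->
  (forall r s, size r = k -> (d <= s)%N -> B (comp_sum f r s)) ->
  forall r, size r = k -> B (f r).
Proof.
move=> hB; have [m] := ubnP (k + d); elim: m k d f => // m IH k d f hm hf hbox hrel.
case: k => [|k] in hm hbox hrel *; first by move=> [|//] _; apply: hbox.
case: d => [|d] in hm hbox hrel *.
  (* For d = 0 the ideal contains h_0 = 1. *)
  by move=> r hr; have := hrel r 0%N hr isT; rewrite comp_sum_nseq0.
have hpos r : size r = k.+1 -> 0%N \notin r -> B (f r).
  move=> hr r0; pose f' r := f (map succn r).
  have -> : r = map succn (map predn r).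
    rewrite -map_comp map_id_in // => i hi /=; rewrite prednK // lt0n.
    by apply: contraNneq r0 => <-.
  have {}hr : size (map predn r) = k.+1 by rewrite size_map.
  apply: (IH k.+1 d f') hr; first by lia.
  - by move=> t t' htt; apply: hf; apply: perm_map.
  - move=> t ht hall; apply: hbox; first by rewrite size_map.
    by rewrite all_map.
  - move=> t s ht hs; have e : comp_sum f' t s = comp_sum f (map succn t) s.
      rewrite {}/f'; elim: t {ht} f s {hf hbox hrel r0 hs} => [|a t IHt] f s //=.
      by apply: eq_bigr => i _; rewrite (IHt (fun u => f ((a + i).+1 :: u))).
    rewrite e; move: hs; rewrite leq_eqVlt => /orP[/eqP <-|hs].
      exact: (comp_sum_shift hB (ltn0Sn k)).
    by apply: hrel => //; rewrite size_map.
(* The divisor makes [del_zero g] agree with [f] on monomials containing 0, so that relations for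
   [f] turn into relations for [g]. *)
pose g r := ((count_mem 0%N r).+1%:R^-1 : A) *: f (0%N :: r).
have gS r : g r *+ (count_mem 0%N r).+1 = f (0%N :: r).
  by rewrite -scaler_nat scalerA mulrV ?scale1r.
have hg : perm_invariant g.
  by move=> t t' htt; rewrite /g (permP htt); congr (_ *: _); apply: hf; rewrite perm_cons.
have del_g r : 0%N \in r -> del_zero g r = f r.
  move=> r0; have hp := perm_to_rem r0.
  by rewrite (perm_invariant_del_zero hg hp) (hf _ _ hp) (del_zero_sym _ hg) gS.
have hBg r : size r = k -> B (g r).
  apply: (IH k d.+1 g); [by lia|exact: hg| |].
  - by move=> t ht hall; apply: submodZ => //; apply: hbox => //=; rewrite ht.
  - move=> t s ht hs; apply: (submod_divn A_nat hB (m := count_mem 0%N t)).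
    rewrite -(del_zero_sym (f := fun t => comp_sum g t s)); last exact: comp_sum_perm.
    rewrite -comp_sum_del_zero.
    have := hrel (0%N :: t) s; rewrite [size _]/= ht => /(_ erefl hs).
    (* Splits off the monomials without exponent 0, which [hpos] has already placed in [B]. *)
    pose fp u := if 0%N \in u then 0 else f u.
    have hfp u : size u = k.+1 -> B (fp u).
      by move=> hu; rewrite /fp; case: ifPn => [_|/hpos]; [exact: submod0|exact].
    have hsum F r' s' : (forall t, size t = size r' -> B (F t)) -> B (comp_sum F r' s').
      elim: r' F s' => [|a r' IHr] F s' hF /=.
        by case: ifP => _; [apply: hF|apply: submod0].
      by apply: submod_sum => // i _; apply: IHr => u hu; apply: hF; rewrite /= hu.
    have -> : comp_sum f (0%N :: t) s = comp_sum fp (0%N :: t) s + comp_sum (del_zero g) (0%N :: t) s.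
      rewrite -comp_sumD; apply: eq_comp_sum => u _; rewrite /fp.
      by case: ifPn => hu; [rewrite add0r del_g|rewrite del_zero_pos ?addr0].
    move=> h; apply: (submod_addKr hB h); apply: hsum => u hu.
    by apply: hfp; rewrite hu /= ht.
move=> r hr; case: (boolP (0%N \in r)) => [r0|]; last exact: hpos.
have hp := perm_to_rem r0; rewrite (hf _ _ hp) -gS; apply: submodMn => //; apply: hBg.
by have := perm_size hp; rewrite hr => -[].
Qed.

End BoxReduction.

(** * Spanning sets for the lowering operators of sl(2)[t] *)

Section Words.
Variables (A : comUnitRingType) (M : lmodType A).
Implicit Types (o : nat -> {linear M -> M}) (r : seq nat).

Definition word o r (v : M) : M := foldr (fun a u => o a u) v r.

Lemma word_cat o r1 r2 v : word o (r1 ++ r2) v = word o r1 (word o r2 v).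
Proof. exact: foldr_cat. Qed.

Lemma word_linear o r : linear (word o r).
Proof. by elim: r => [|a r IH] c u v //=; rewrite IH linearP. Qed.
HB.instance Definition _ o r :=
  GRing.isLinear.Build A M M *:%R (word o r) (word_linear o r).

Lemma word_comm o (f : M -> M) r v :
  (forall a u, f (o a u) = o a (f u)) -> f (word o r v) = word o r (f v).
Proof. by move=> hf; elim: r => //= a r <-. Qed.

Lemma word_perm_invariant o v : (forall i j u, o i (o j u) = o j (o i u)) ->
  perm_invariant (fun r => word o r v).
Proof.
move=> oo t; elim: t => [|a t IH] t' ht; first by move/perm_size/esym/size0nil: ht ->.
have hat : a \in t' by rewrite -(perm_mem ht) mem_head.
case/splitPr: hat ht => p1 p2; rewrite perm_sym -cat1s perm_catCA /= perm_cons perm_sym => ht.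
rewrite (IH _ ht) !word_cat /= (word_comm (f := o a)) // => b u; exact: oo.
Qed.

Lemma comp_sum_word_cons o a r s v :
  comp_sum (word o ^~ v) (a :: r) s = \sum_(i < s.+1) o (a + i)%N (comp_sum (word o ^~ v) r (s - i)).
Proof. by apply: eq_bigr => i _ /=; rewrite comp_sum_linear. Qed.

End Words.

Section Sl2.
Variables (A : comUnitRingType) (M : lmodType A).
Hypothesis A_nat : invertible_nats A.
Variables (y h x : nat -> {linear M -> M}).
Hypothesis yyC : forall i j u, y i (y j u) = y j (y i u).
Hypothesis hyC : forall i j u, h i (y j u) = y j (h i u) - y (i + j)%N u *+ 2.
Hypothesis xyC : forall i j u, x i (y j u) = y j (x i u) + h (i + j)%N u.
Variables (E F : M -> Prop) (N : nat).
Hypothesis F_y : forall i u, F u -> F (y i u).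
Hypothesis F_h : forall i u, F u -> F (h i u).
Hypothesis F_x : forall i u, F u -> F (x i u).
Hypothesis E_h : forall i e, E e -> E (h i e).
Hypothesis E_x : forall i e, E e -> F (x i e).
Hypothesis E_y0 : forall k e, E e -> (N < k)%N -> F (word y (nseq k 0%N) e).
Implicit Types (r t : seq nat) (s k d : nat).

(** The error terms of a computation to leading order in t. Vectors of [E] behave modulo [F] like
    highest weight vectors on which y_0^(N+1) vanishes. *)
Definition lower k d : M -> Prop :=
  lin_span (fun u => F u \/ exists r e, [/\ size r = k, (sumn r < d)%N, E e & u = word y r e]).

Let lower_submod k d : submod (lower k d). Proof. exact: lin_span_submod. Qed.

Lemma lower_F k d u : F u -> lower k d u.
Proof. by move=> hu; apply: lin_span_base; left. Qed.

Lemma lower_word k d r e : size r = k -> (sumn r < d)%N -> E e -> lower k d (word y r e).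
Proof. by move=> hr hd he; apply: lin_span_base; right; exists r, e. Qed.

Lemma lower_mono k d d' u : (d <= d')%N -> lower k d u -> lower k d' u.
Proof.
move=> hd; apply: lin_span_min => // {}u [|[r [e [hr hs he ->]]]]; first exact: lower_F.
by apply: lower_word => //; apply: leq_trans hd.
Qed.

Lemma lower_y k d i u : lower k d u -> lower k.+1 (i + d) (y i u).
Proof.
move: u; apply: lin_span_min; first exact: submod_preim.
move=> u [hu|[r [e [hr hs he ->]]]]; first by apply/lower_F/F_y.
by apply: (@lower_word _ _ (i :: r)) => //=; rewrite ?hr // ltn_add2l.
Qed.

Lemma lower_h k d i u : lower k d u -> lower k (i + d) (h i u).
Proof.
move: u; apply: lin_span_min; first exact: submod_preim.
move=> u [hu|[r [e [hr hs he ->]]]]; first by apply/lower_F/F_h.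
elim: r k d hr hs => [|a r IH] k d hr hs /=.
  by apply: (@lower_word _ _ [::]) => //=; [lia|apply: E_h].
case: k hr => // k [hr]; rewrite hyC; rewrite /= in hs.
apply: submodB => //.
  apply: (@lower_mono _ (a + (i + (sumn r).+1))); first by lia.
  by apply: lower_y; apply: (IH _ (sumn r).+1).
apply: submodMn => //; apply: (@lower_word _ _ ((i + a)%N :: r)) => //=; rewrite ?hr //; lia.
Qed.

(** Moving x_i to the right trades one letter y_j for h_(i+j), which adds at most i + j to the
    degree of what follows. The remaining term has x_i on a vector of [E] and lies in [F]. *)
Lemma lower_x k d i u : lower k.+1 d u -> lower k (i + d) (x i u).
Proof.
move: u; apply: lin_span_min; first exact: submod_preim.
move=> u [hu|[r [e [hr hs he ->]]]]; first by apply/lower_F/F_x.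
case: r hr hs => [//|a r] [hr] hs /=; rewrite xyC; rewrite /= in hs.
apply: submodD => //; last first.
  apply: (@lower_mono _ ((i + a) + (sumn r).+1)); first by lia.
  by apply: lower_h; apply: lower_word.
elim: r k hr a d hs => [|b r IH] k hr a d hs /=.
  by apply: lower_F; apply: F_y; apply: E_x.
case: k hr => // k [hr]; rewrite /= in hs.
apply: (@lower_mono _ (a + (i + (b + sumn r).+1))); first by lia.
apply: lower_y; rewrite xyC; apply: submodD => //; first exact: (IH _ hr b (b + sumn r).+1).
apply: (@lower_mono _ ((i + b) + (sumn r).+1)); first by lia.
by apply: lower_h; apply: lower_word.
Qed.

Local Notation S r s e := (comp_sum (word y ^~ e) r s).

Let S_perm e s : perm_invariant (fun r => S r s e).
Proof. by apply: comp_sum_perm; apply: word_perm_invariant. Qed.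

(* Up to the factor [-2], the leading part of the action of [h j]. *)
Fixpoint raise (f : seq nat -> M) j r : M :=
  if r is a :: r' then f ((j + a)%N :: r') + raise (fun t => f (a :: t)) j r' else 0.

Lemma eq_raise f g j r : (forall t, size t = size r -> f t = g t) -> raise f j r = raise g j r.
Proof.
elim: r f g => //= a r IH f g fg; rewrite fg //; congr (_ + _); apply: IH => t ht.
by apply: fg; rewrite /= ht.
Qed.

Lemma raise_sum n (f : 'I_n -> seq nat -> M) j r :
  raise (fun t => \sum_(i < n) f i t) j r = \sum_(i < n) raise (f i) j r.
Proof.
elim: r f => [|a r IH] f /=; first by rewrite big1.
by rewrite IH -big_split.
Qed.

Lemma raise_linear (f : seq nat -> M) (g : {linear M -> M}) j r :
  raise (fun t => g (f t)) j r = g (raise f j r).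
Proof. by elim: r f => [|a r IH] f /=; rewrite ?linear0 // linearD IH. Qed.

Lemma raise_cat f j r1 r2 :
  raise f j (r1 ++ r2) = raise (fun t => f (t ++ r2)) j r1 + raise (fun t => f (r1 ++ t)) j r2.
Proof. by elim: r1 f => [|a r1 IH] f /=; rewrite ?add0r // IH addrA. Qed.

Lemma raise_nseq f j k : perm_invariant f ->
  raise f j (nseq k.+1 0%N) = f (j :: nseq k 0%N) *+ k.+1.
Proof.
elim: k f => [|k IH] f hf; first by rewrite /= addn0 addr0.
have := IH (fun t => f (0%N :: t)) (perm_invariant_cons 0%N hf).
rewrite /= addn0 => ->; rewrite [RHS]mulrS; congr (_ + _); congr (_ *+ _).
exact: perm_invariant_swap.
Qed.

Lemma raise_mem B f j r : submod B ->
  (forall t, size t = size r -> sumn t = (j + sumn r)%N -> B (f t)) -> B (raise f j r).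
Proof.
move=> hB; elim: r f => [|a r IH] f hf /=; first exact: submod0.
apply: submodD => //; first by apply: hf => //=; rewrite addnA.
by apply: IH => t ht hs; apply: hf; rewrite /= ?ht // hs addnCA.
Qed.

(** Bracketing with h_j is a derivation on words. It acts as -2 times multiplication by the power
    sum p_j, which commutes with multiplication by h_s. *)
Lemma h_comp_sum j r s e : h j (S r s e) = S r s (h j e) - raise (fun t => S t s e) j r *+ 2.
Proof.
elim: r s => [|a r IH] s.
  by rewrite /= mul0rn subr0; case: ifP => // _; rewrite linear0.
have raise_cons : raise (fun t => S t s e) j (a :: r) =
    S ((j + a)%N :: r) s e + raise (fun t => S (a :: t) s e) j r by [].
rewrite raise_cons !comp_sum_word_cons linear_sum.
rewrite (@eq_raise (fun t => S (a :: t) s e) (fun t => \sum_(i < s.+1) y (a + i)%N (S t (s - i) e))); last first.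
  by move=> t _; rewrite comp_sum_word_cons.
rewrite raise_sum -big_split -sumrMnl -sumrB; apply: eq_bigr => i _ /=.
rewrite hyC IH raise_linear linearB linearMn mulrnDl [in RHS]opprD addnA.
by rewrite addrA addrAC.
Qed.

Lemma comp_sum1 s v : S [:: 0%N] s v = y s v.
Proof.
rewrite comp_sum_word_cons big_ord_recr /= subnn /= big1 ?add0r // => i _.
by rewrite subn_eq0 leqNgt ltn_ord /= linear0.
Qed.

Lemma comp_sum_lower r s d e : (sumn r + s < d)%N -> E e -> lower (size r) d (S r s e).
Proof.
move=> hd he; elim: r s d hd => [|a r IH] s d hd.
  rewrite /=; case: eqP => [s0|_]; last exact: submod0.
  by apply: (@lower_word _ _ [::]) => //=; lia.
rewrite comp_sum_word_cons; apply: submod_sum => // i _; rewrite /= in hd.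
have hi := ltn_ord i.
apply: (@lower_mono _ ((a + i) + (sumn r + (s - i)).+1)); first by lia.
by apply: lower_y; apply: IH.
Qed.

Lemma comp_sum_word_nseq k s v :
  S (nseq k.+1 0%N) s v = \sum_(i < s.+1) y i (S (nseq k 0%N) (s - i) v).
Proof. exact: comp_sum_word_cons. Qed.

(* Coefficient of [z^s] in [(k + 1) z Y' Y^k = z (Y^(k+1))'], where [Y] is the generating
   series of the [y i]. *)
Lemma comp_sum_euler k s v :
  (\sum_(c < s.+1) y c (S (nseq k 0%N) (s - c) v) *+ c) *+ k.+1 = S (nseq k.+1 0%N) s v *+ s.
Proof.
elim: k s => [|k IH] s.
  rewrite mulr1n comp_sum_word_nseq -sumrMnl; apply: eq_bigr => c _ /=.
  have := ltn_ord c; rewrite ltnS subn_eq0 => hc; case: leqP => hs.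
    by congr (_ *+ _); apply/eqP; rewrite eqn_leq hc.
  by rewrite linear0 !mul0rn.
rewrite [RHS](_ : _ = \sum_(c < s.+1) y c (S (nseq k.+1 0%N) (s - c) v) *+ c
  + \sum_(c < s.+1) y c (S (nseq k.+1 0%N) (s - c) v *+ (s - c))); last first.
  rewrite comp_sum_word_nseq -sumrMnl -big_split; apply: eq_bigr => c _.
  by rewrite /= linearMn -mulrnDr subnKC // -ltnS.
rewrite mulrS; congr (_ + _).
under [RHS]eq_bigr => c _ do rewrite -IH linearMn.
rewrite sumrMnl; congr (_ *+ _).
under [RHS]eq_bigr => c _ do rewrite linear_sum.
rewrite (exchange_triangle s (fun c b => y c (y b (S (nseq k 0%N) (s - c - b) v) *+ b))).
apply: eq_bigr => b _; rewrite comp_sum_word_nseq linear_sum -sumrMnl.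
by apply: eq_bigr => c _; rewrite linearMn yyC -!subnDA addnC.
Qed.

Lemma triangle_antidiag s (G : nat -> M) :
  \sum_(i < s.+1) \sum_(j < (s - i).+1) G (i + j)%N = \sum_(c < s.+1) G c *+ c.+1.
Proof.
elim: s => [|s IH]; first by rewrite !big_ord1.
rewrite [RHS]big_ord_recr /= -IH.
transitivity (\sum_(i < s.+2) (\sum_(j < (s.+1 - i)) G (i + j)%N + G s.+1)).
  by apply: eq_bigr => i _; rewrite big_ord_recr /= subnKC // -ltnS.
rewrite big_split /= sumr_const card_ord; congr (_ + _).
rewrite big_ord_recr /= subnn big_ord0 addr0; apply: eq_bigr => i _.
by rewrite subSn // -ltnS.
Qed.

(** With Y the generating series of the y_i, each of the k(k+1)/2 pairs of letters in Y^(k+1)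
    contributes -2 times the sum of y_(i+j+1) z^(i+j), that is -2 Y', through the bracket of x_1
    with y_i and then of h_(i+1) with y_j. The leading part of x_1 Y^(k+1) e is thus -(k+1) k Y'
    Y^(k-1) e = -(k+1) (Y^k)' e, and the coefficient of z^s is compared. *)
Lemma x_comp_sum k s e : E e ->
  lower k s.+1 (x 1%N (S (nseq k.+1 0%N) s e) + S (nseq k 0%N) s.+1 e *+ (k.+1 * s.+1)).
Proof.
move=> he; elim: k s => [|k IH] s.
  rewrite comp_sum1 /= mul0rn addr0 xyC; apply: submodD => //.
    by apply/lower_F/F_y/E_x.
  by apply: (@lower_word _ _ [::]) => //; apply: E_h.
set T := S (nseq k.+1 0%N) s.+1 e.
set W := \sum_(c < s.+2) y c (S (nseq k 0%N) (s.+1 - c) e) *+ c.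
have hW : W *+ k.+1 = T *+ s.+1 by apply: comp_sum_euler.
pose V i := S (i.+1 :: nseq k 0%N) (s - i) e.
(* There are c + 1 pairs with i + j = c, and these multiplicities are the exponents brought down by
   the derivative Y'. *)
have hV : \sum_(i < s.+1) V i = W.
  transitivity (\sum_(i < s.+1) \sum_(j < (s - i).+1)
      y (i + j).+1 (S (nseq k 0%N) (s - (i + j)) e)).
    apply: eq_bigr => i _; rewrite /V comp_sum_word_cons; apply: eq_bigr => j _.
    by rewrite addSn -subnDA.
  rewrite (triangle_antidiag s (fun c => y c.+1 (S (nseq k 0%N) (s - c) e))).
  by rewrite /W [RHS]big_ord_recl mulr0n add0r.
have hU : \sum_(i < s.+1) y i (S (nseq k 0%N) (s - i).+1 e) *+ (s - i).+1 + W = T *+ s.+1.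
  rewrite /T comp_sum_word_nseq -sumrMnl /W [X in _ + X]big_ord_recr [RHS]big_ord_recr /=.
  rewrite addrA -big_split; congr (_ + _); apply: eq_bigr => i _ /=.
  have hi : (i <= s)%N by rewrite -ltnS.
  by rewrite -subSn // -mulrnDr subnK // ltnW.
have -> : T *+ (k.+2 * s.+1) =
    (\sum_(i < s.+1) y i (S (nseq k 0%N) (s - i).+1 e) *+ (s - i).+1) *+ k.+1 +
    W *+ (k.+1 * 2).
  have -> : T *+ (k.+2 * s.+1) = T *+ s.+1 *+ k.+1 + T *+ s.+1.
    by rewrite -mulrnA -mulrnDr; congr (_ *+ _); ring.
  by rewrite -{2}hW -hU mulrnDl -addrA -mulrnDr; congr (_ + _ *+ _); ring.
pose P i := S (nseq k.+1 0%N) (s - i) e.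
have -> : x 1%N (S (nseq k.+2 0%N) s e) = \sum_(i < s.+1) (y i (x 1%N (P i)) + h (1 + i)%N (P i)).
  by rewrite comp_sum_word_nseq linear_sum; apply: eq_bigr => i _; rewrite xyC.
rewrite -hV addrA -!sumrMnl -!big_split /=.
apply: submod_sum => // i _; have hi : (i <= s)%N by rewrite -ltnS.
rewrite -addrA addrACA; apply: submodD => //.
  rewrite -mulrnA mulnC -linearMn -linearD.
  apply: (@lower_mono _ (i + (s - i).+1)); first by lia.
  by apply: lower_y; apply: IH.
rewrite /P h_comp_sum raise_nseq; last exact: S_perm.
rewrite /V mulrnA add1n addrNK.
have := @comp_sum_lower (nseq k.+1 0%N) (s - i) s.+1 (h i.+1 e).
by rewrite size_nseq; apply; [rewrite sumn_nseq mul0n; lia|exact: E_h].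
Qed.

(** Starts from y_0^(k+s) e, which lies in [F]. Each application of x_1 exchanges one letter for one
    unit of t-degree, with an invertible coefficient. *)
Lemma comp_sum_nseq_lower k s e : E e -> (N < k + s)%N -> lower k s (S (nseq k 0%N) s e).
Proof.
elim: s k => [|s IH] k he hN.
  by rewrite comp_sum_nseq0; apply/lower_F/E_y0; rewrite // -(addn0 k).
have h1 : lower k s.+1 (x 1%N (S (nseq k.+1 0%N) s e)).
  by rewrite -add1n; apply: lower_x; apply: IH; rewrite // addSnnS.
have := submod_addKr (lower_submod _ _) (x_comp_sum k s he) h1.
by rewrite mulSn addSn; apply: submod_divn.
Qed.

(** Passes from h_s to its products with monomials. Since h_j acts as a power sum, it can be used to
    raise the exponents from 0 to their values one at a time. *)
Lemma comp_sum_rel_lower k s r e : (N < k + s)%N -> size r = k -> E e ->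
  lower k (sumn r + s) (S r s e).
Proof.
move=> hN; suff key i m t u : size t = i -> (i + m)%N = k -> E u ->
    lower k (sumn t + s) (S (t ++ nseq m 0%N) s u).
  by move=> hr; have := key k 0%N r e hr; rewrite cats0 addn0; apply.
elim: i m t u => [|i IH] m t u ht hk hu.
  by case: t ht => // _; rewrite /= add0n in hk *; rewrite hk; apply: comp_sum_nseq_lower.
case: t ht => [//|j t] [ht] /=.
have hk' : (i + m.+1)%N = k by rewrite addnS.
have := h_comp_sum j (t ++ nseq m.+1 0%N) s u.
move/eqP; rewrite eq_sym subr_eq addrC -subr_eq => /eqP /esym hr.
have : lower k (j + sumn t + s) (raise (fun r' => S r' s u) j (t ++ nseq m.+1 0%N) *+ 2).
  rewrite hr; apply: submodB => //.
    by apply: (lower_mono _ (IH m.+1 t _ ht hk' (E_h j hu))); rewrite -addnA leq_addl.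
  by rewrite -addnA; apply: lower_h; apply: IH.
move/(submod_divn A_nat (lower_submod _ _)); rewrite raise_cat => h1.
(* Raising a letter inside [t] does not lengthen [t], so induction covers these terms. The m + 1
   zeros then give m + 1 equal terms. *)
have h2 : lower k (j + sumn t + s) (raise (fun r' => S (r' ++ nseq m.+1 0%N) s u) j t).
  apply: raise_mem => // t' ht' hs'; rewrite -hs'; apply: IH => //; by rewrite ht'.
have := submod_addKr (lower_submod _ _) h1 h2.
rewrite raise_nseq; last by apply: perm_invariant_cat (S_perm u s).
move/(submod_divn A_nat (lower_submod _ _)).
by rewrite (S_perm u s (_ : perm_eq _ (j :: t ++ nseq m 0%N))) // -cat1s perm_catCA.
Qed.

(** Induction on the t-degree: errors of lower degree are already in [B]. Restricting [word] to
    degree [D] then makes the leading-order relations exact, as [box_reduction] requires. *)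
Theorem sl2_word_mem (B : M -> Prop) k :
  submod B -> (forall u, F u -> B u) ->
  (forall r e, size r = k -> all (fun i => i < N.+1 - k)%N r -> E e -> B (word y r e)) ->
  forall r e, size r = k -> E e -> B (word y r e).
Proof.
move=> hB hF hbox r e hr he.
have [D] := ubnP (sumn r); elim: D r e hr he => // D IH r e hr he hD.
have [hlt|hge] := ltnP (sumn r) D; first exact: IH.
have {hge hD} hD : sumn r = D by apply/eqP; rewrite eqn_leq hge -ltnS hD.
have hlow u : lower k D u -> B u.
  apply: lin_span_min => // {}u [/hF //|[t [v [ht hs hv ->]]]]; exact: IH.
pose f t := if sumn t == D then word y t e else 0.
have -> : word y r e = f r by rewrite /f hD eqxx.
apply: (box_reduction A_nat (d := (N.+1 - k)%N) hB) hr.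
- move=> t t' htt; rewrite /f (perm_sumn htt).
  by rewrite (word_perm_invariant e yyC htt).
- by move=> t ht hall; rewrite /f; case: ifP => _; [apply: hbox|apply: submod0].
- move=> t s ht hs; rewrite /f comp_sum_graded; case: eqP => [hDs|_]; last exact: submod0.
  by apply: hlow; rewrite -hDs; apply: comp_sum_rel_lower => //; lia.
Qed.

End Sl2.

(** * Anticommuting operators *)

Section Anticommuting.
Variables (A : comUnitRingType) (M : lmodType A).
Hypothesis A_nat : invertible_nats A.
Variable o : nat -> {linear M -> M}.
Hypothesis ooC : forall i j u, o i (o j u) = - o j (o i u).

Lemma word_anti_move a p u : o a (word o p u) = (-1) ^+ size p *: word o p (o a u).
Proof.
elim: p => [|b p IH] /=; first by rewrite scale1r.
by rewrite ooC IH linearZ exprS mulN1r scaleNr.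
Qed.

Lemma word_anti_perm p p' u : perm_eq p p' ->
  exists e : nat, word o p u = (-1) ^+ e *: word o p' u.
Proof.
elim: p p' => [|a p IH] p' hp.
  by exists 0%N; move/perm_size/esym/size0nil: hp => ->; rewrite scale1r.
have hap : a \in p' by rewrite -(perm_mem hp) mem_head.
case/splitPr: hap hp => p1 p2; rewrite perm_sym -cat1s perm_catCA /= perm_cons perm_sym => hp.
have [e he] := IH _ hp; exists (e + size p1)%N.
rewrite he linearZ word_cat /= word_anti_move scalerA -exprD word_cat.
by [].
Qed.

Lemma word_anti_nuniq p u : ~~ uniq p -> word o p u = 0.
Proof.
elim: p => [//|a p IH] /=; rewrite negb_and negbK => /orP[|/IH ->]; last by rewrite linear0.
case/splitPr => p1 p2; rewrite word_cat /= word_anti_move.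
suff -> : o a (o a (word o p2 u)) = 0 by rewrite linear0 scaler0.
apply: (submod_divn (m := 1) A_nat (submod_zero M)).
by rewrite mulr2n {1}ooC addNr.
Qed.

(** The reduction of a single letter is expressed through all submodules [B], so that it can be
    pulled back along the word standing to its left. *)
Lemma word_anti_reduce (E F : M -> Prop) (L a : nat) :
  (forall B, submod B -> (forall i e, (i < L)%N -> E e -> B (o i e)) ->
     (forall u, F u -> B u) -> forall i e, E e -> B (o i e)) ->
  forall B, submod B ->
  (forall p e, size p = a -> all (fun i => i < L)%N p -> E e -> B (word o p e)) ->
  (forall t u, size t = a.-1 -> F u -> B (word o t u)) ->
  forall p e, size p = a -> E e -> B (word o p e).
Proof.
move=> hred B hB hbase hF p e hp he.
(* The letters of [p2] have been treated, those of [p1] have not. The next one is moved next to the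
   vector at the cost of a sign. *)
suff key m p1 p2 e' : size p1 = m -> size (p1 ++ p2) = a -> all (fun i => i < L)%N p2 ->
    E e' -> B (word o (p1 ++ p2) e').
  by rewrite -(cats0 p); apply: (key (size p)); rewrite ?cats0.
elim: m p1 p2 e' => [|m IH] p1 p2 e' h1 h2 h3 he'.
  by rewrite (size0nil h1) in h2 *; apply: hbase.
case: p1 h1 h2 => [//|b p1] [h1] h2 /=; rewrite word_anti_move.
apply: submodZ => //; move: b e' he' h2.
move=> b e' he' h2; apply: (hred (fun u => B (word o (p1 ++ p2) u))) he'.
- exact: (submod_preim (word o (p1 ++ p2)) hB).
- move=> i e'' hi he''.
  have -> : word o (p1 ++ p2) (o i e'') = word o (p1 ++ rcons p2 i) e''.
    by rewrite -cats1 catA [RHS]word_cat.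
  apply: IH => //; last by rewrite all_rcons hi.
  by rewrite -h2 /= !size_cat size_rcons addnS.
- by move=> u hu; apply: hF => //; rewrite -h2.
Qed.

End Anticommuting.

(** * The spanning set *)

Record sl12_ops (A : comUnitRingType) (M : lmodType A) := Sl12Ops {
  X1 : nat -> {linear M -> M}; X2 : nat -> {linear M -> M}; X3 : nat -> {linear M -> M};
  Y1 : nat -> {linear M -> M}; Y2 : nat -> {linear M -> M}; Y3 : nat -> {linear M -> M};
  H1 : nat -> {linear M -> M}; H2 : nat -> {linear M -> M} }.

(* Only the superbrackets with [x1], [y2], [y3] matter for straightening. *)
Record sl12_rel (A : comUnitRingType) (M : lmodType A) (o : sl12_ops M) : Prop := Sl12Rel {
  Y2Y2 : forall i j u, Y2 o i (Y2 o j u) = Y2 o j (Y2 o i u);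
  Y2X1 : forall i j u, Y2 o i (X1 o j u) = X1 o j (Y2 o i u);
  Y2Y3 : forall i j u, Y2 o i (Y3 o j u) = Y3 o j (Y2 o i u);
  X1X1 : forall i j u, X1 o i (X1 o j u) = - X1 o j (X1 o i u);
  Y3Y3 : forall i j u, Y3 o i (Y3 o j u) = - Y3 o j (Y3 o i u);
  Y3X1 : forall i j u, Y3 o i (X1 o j u) = - X1 o j (Y3 o i u) + Y2 o (i + j)%N u;
  H1Y2 : forall i j u, H1 o i (Y2 o j u) = Y2 o j (H1 o i u) - Y2 o (i + j)%N u;
  H2Y2 : forall i j u, H2 o i (Y2 o j u) = Y2 o j (H2 o i u) - Y2 o (i + j)%N u *+ 2;
  X2Y2 : forall i j u, X2 o i (Y2 o j u) = Y2 o j (X2 o i u) + H2 o (i + j)%N u;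
  X3Y2 : forall i j u, X3 o i (Y2 o j u) = Y2 o j (X3 o i u) + X1 o (i + j)%N u;
  Y1Y2 : forall i j u, Y1 o i (Y2 o j u) = Y2 o j (Y1 o i u) - Y3 o (i + j)%N u;
  H1X1 : forall i j u, H1 o i (X1 o j u) = X1 o j (H1 o i u);
  H2X1 : forall i j u, H2 o i (X1 o j u) = X1 o j (H2 o i u) - X1 o (i + j)%N u;
  X2X1 : forall i j u, X2 o i (X1 o j u) = X1 o j (X2 o i u) - X3 o (i + j)%N u;
  X3X1 : forall i j u, X3 o i (X1 o j u) = - X1 o j (X3 o i u);
  Y1X1 : forall i j u, Y1 o i (X1 o j u) = - X1 o j (Y1 o i u) + H1 o (i + j)%N u;
  H1Y3 : forall i j u, H1 o i (Y3 o j u) = Y3 o j (H1 o i u) - Y3 o (i + j)%N u;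
  H2Y3 : forall i j u, H2 o i (Y3 o j u) = Y3 o j (H2 o i u) - Y3 o (i + j)%N u;
  X2Y3 : forall i j u, X2 o i (Y3 o j u) = Y3 o j (X2 o i u) + Y1 o (i + j)%N u;
  X3Y3 : forall i j u, X3 o i (Y3 o j u) =
    - Y3 o j (X3 o i u) + (H1 o (i + j)%N u - H2 o (i + j)%N u);
  Y1Y3 : forall i j u, Y1 o i (Y3 o j u) = - Y3 o j (Y1 o i u) }.

Record hw_vector (A : comUnitRingType) (M : lmodType A) (o : sl12_ops M)
    (psi1 psi2 : nat -> A) (n : nat) (w : M) : Prop := HwVector {
  hw_Y1 : forall i, Y1 o i w = 0;
  hw_X2 : forall i, X2 o i w = 0;
  hw_X3 : forall i, X3 o i w = 0;
  hw_H1 : forall i, H1 o i w = psi1 i *: w;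
  hw_H2 : forall i, H2 o i w = psi2 i *: w;
  hw_psi2 : psi2 0%N = n%:R;
  hw_Y2 : word (Y2 o) (nseq n.+1 0%N) w = 0 }.

Section Spanning.
Variables (A : comUnitRingType) (M : lmodType A).
Hypothesis A_nat : invertible_nats A.
Variable o : sl12_ops M.
Hypothesis oR : sl12_rel o.
Variables (psi1 psi2 : nat -> A) (n : nat) (w : M).
Hypothesis hw : hw_vector o psi1 psi2 n w.

Local Notation X1 := (X1 o).
Local Notation X2 := (X2 o).
Local Notation X3 := (X3 o).
Local Notation Y1 := (Y1 o).
Local Notation Y2 := (Y2 o).
Local Notation Y3 := (Y3 o).
Local Notation H1 := (H1 o).
Local Notation H2 := (H2 o).

Definition monomial (r p q : seq nat) : M := word Y2 r (word X1 p (word Y3 q w)).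

(** Only the numbers of odd factors are fixed, not their exponents: this makes the space stable
    under [h1] and [h2] currents and lets it serve as [E] in the sl(2)[t] argument. *)
Definition odd_span a b : M -> Prop :=
  lin_span (fun u => exists p q, [/\ size p = a, size q = b & u = word X1 p (word Y3 q w)]).

Definition filt s : M -> Prop :=
  lin_span (fun u => exists r p q, (size p + size q < s)%N /\ u = monomial r p q).

Definition monomial_span : M -> Prop := lin_span (fun u => exists r p q, u = monomial r p q).

Lemma odd_span_word p q : odd_span (size p) (size q) (word X1 p (word Y3 q w)).
Proof. by apply: lin_span_base; exists p, q. Qed.

Lemma odd_span_X1 a b i u : odd_span a b u -> odd_span a.+1 b (X1 i u).
Proof.
move: u; apply: lin_span_min; first exact/submod_preim/lin_span_submod.
by move=> _ [p [q [<- <- ->]]]; apply: (odd_span_word (i :: p)).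
Qed.

Lemma odd_span_Y3 b i u : odd_span 0 b u -> odd_span 0 b.+1 (Y3 i u).
Proof.
move: u; apply: lin_span_min; first exact/submod_preim/lin_span_submod.
by move=> _ [p [q [/size0nil -> <- ->]]]; apply: (odd_span_word [::] (i :: q)).
Qed.

Lemma odd_span_ind0 (S : M -> Prop) : submod S -> S w -> forall u, odd_span 0 0 u -> S u.
Proof. by move=> hS hw'; apply: lin_span_min => // _ [p [q [/size0nil -> /size0nil -> ->]]]. Qed.

Lemma odd_span_indY b (S : M -> Prop) : submod S ->
  (forall i u, odd_span 0 b u -> S (Y3 i u)) -> forall u, odd_span 0 b.+1 u -> S u.
Proof.
move=> hS h; apply: lin_span_min => // _ [p [[|i q] [/size0nil -> // [hq] ->]]].
by apply: h; rewrite -hq; apply: (odd_span_word [::]).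
Qed.

Lemma odd_span_indX a b (S : M -> Prop) : submod S ->
  (forall i u, odd_span a b u -> S (X1 i u)) -> forall u, odd_span a.+1 b u -> S u.
Proof.
move=> hS h; apply: lin_span_min => // _ [[|i p] [q [// [hp] hq ->]]].
by apply: h; rewrite -hp -hq; apply: odd_span_word.
Qed.

Let odd_submod a b : submod (odd_span a b). Proof. exact: lin_span_submod. Qed.
Let filt_submod s : submod (filt s). Proof. exact: lin_span_submod. Qed.
Let mspan_submod : submod monomial_span. Proof. exact: lin_span_submod. Qed.

Lemma odd_span_H1 a b i u : odd_span a b u -> odd_span a b (H1 i u).
Proof.
elim: a i u => [|a IH] i u; [elim: b i u => [|b IH] i u|]; move: u.
- apply: odd_span_ind0; first exact: submod_preim.
  by rewrite (hw_H1 hw); apply: submodZ => //; apply: (odd_span_word [::] [::]).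
- apply: odd_span_indY => [|j u hu]; first exact: submod_preim.
  by rewrite (H1Y3 oR); apply: submodB => //; apply: odd_span_Y3 => //; apply: IH.
- apply: odd_span_indX => [|j u hu]; first exact: submod_preim.
  by rewrite (H1X1 oR); apply: odd_span_X1; apply: IH.
Qed.

Lemma odd_span_H2 a b i u : odd_span a b u -> odd_span a b (H2 i u).
Proof.
elim: a i u => [|a IH] i u; [elim: b i u => [|b IH] i u|]; move: u.
- apply: odd_span_ind0; first exact: submod_preim.
  by rewrite (hw_H2 hw); apply: submodZ => //; apply: (odd_span_word [::] [::]).
- apply: odd_span_indY => [|j u hu]; first exact: submod_preim.
  by rewrite (H2Y3 oR); apply: submodB => //; apply: odd_span_Y3 => //; apply: IH.
- apply: odd_span_indX => [|j u hu]; first exact: submod_preim.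
  by rewrite (H2X1 oR); apply: submodB => //; apply: odd_span_X1 => //; apply: IH.
Qed.

Lemma odd_span_X3_0 a i u : odd_span a 0 u -> X3 i u = 0.
Proof.
have hS j := submod_preim (X3 j) (submod_zero M).
elim: a i u => [|a IH] i.
  by apply: odd_span_ind0 => //; rewrite (hw_X3 hw).
by apply: odd_span_indX => // j u hu; rewrite (X3X1 oR) IH // linear0 oppr0.
Qed.

Lemma odd_span_X3 a b i u : odd_span a b.+1 u -> odd_span a b (X3 i u).
Proof.
elim: a i u => [|a IH] i u; move: u.
  elim: b i => [|b IH] i; (apply: odd_span_indY => [|j u hu]; first exact: submod_preim);
    rewrite (X3Y3 oR); (apply: submodD => //;
    last by apply: submodB => //; [apply: odd_span_H1|apply: odd_span_H2]).
    by rewrite (odd_span_X3_0 _ hu) linear0 oppr0; apply: submod0.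
  by apply: submodN => //; apply: odd_span_Y3; apply: IH.
apply: odd_span_indX => [|j u hu]; first exact: submod_preim.
by rewrite (X3X1 oR); apply: submodN => //; apply: odd_span_X1; apply: IH.
Qed.

Lemma odd_span_Y1 b i u : odd_span 0 b u -> Y1 i u = 0.
Proof.
have hS j := submod_preim (Y1 j) (submod_zero M).
elim: b i u => [|b IH] i.
  by apply: odd_span_ind0 => //; rewrite (hw_Y1 hw).
by apply: odd_span_indY => // j u hu; rewrite (Y1Y3 oR) IH // linear0 oppr0.
Qed.

Lemma odd_span_X2_0 b i u : odd_span 0 b u -> X2 i u = 0.
Proof.
have hS j := submod_preim (X2 j) (submod_zero M).
elim: b i u => [|b IH] i.
  by apply: odd_span_ind0 => //; rewrite (hw_X2 hw).
by apply: odd_span_indY => // j u hu; rewrite (X2Y3 oR) IH // (odd_span_Y1 _ hu) linear0 addr0.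
Qed.

Lemma odd_span_weight a b u : odd_span a b u -> H2 0%N u = (n%:R - (a + b)%:R) *: u.
Proof.
have hS (c : A) : submod (fun u => H2 0%N u = c *: u).
  split=> [|u1 u2 h1 h2|d u1 h1]; first by rewrite linear0 scaler0.
    by rewrite linearD h1 h2 scalerDr.
  by rewrite linearZ /= h1 !scalerA mulrC.
elim: a u => [|a IH]; [elim: b => [|b IH]|].
- by apply: odd_span_ind0 => //; rewrite (hw_H2 hw) (hw_psi2 hw) subr0.
- apply: odd_span_indY => // j u hu.
  by rewrite (H2Y3 oR) IH // linearZ /= !add0n -natr1 opprD addrA [in RHS]scalerDl scaleN1r.
- apply: odd_span_indX => // j u hu.
  by rewrite (H2X1 oR) IH // linearZ /= add0n addSn -natr1 opprD addrA [in RHS]scalerDl scaleN1r.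
Qed.

Lemma filt_ind s (S : M -> Prop) : submod S ->
  (forall r a b e, (a + b < s)%N -> odd_span a b e -> S (word Y2 r e)) ->
  forall u, filt s u -> S u.
Proof.
move=> hS h; apply: lin_span_min => // _ [r [p [q [hs ->]]]].
by apply: h hs _; apply: odd_span_word.
Qed.

Lemma filt_Y2 s i u : filt s u -> filt s (Y2 i u).
Proof.
move: u; apply: lin_span_min; first exact: submod_preim.
by move=> _ [r [p [q [hs ->]]]]; apply: lin_span_base; exists (i :: r), p, q.
Qed.

Lemma filt_word s r u : filt s u -> filt s (word Y2 r u).
Proof. by move=> hu; elim: r => //= i r IH; apply: filt_Y2. Qed.

Lemma filt_X1 s i u : filt s u -> filt s.+1 (X1 i u).
Proof.
move: u; apply: lin_span_min; first exact: submod_preim.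
move=> _ [r [p [q [hs ->]]]]; apply: lin_span_base; exists r, (i :: p), q; split=> //.
by rewrite /monomial (word_comm (f := X1 i)) // => a u; rewrite (Y2X1 oR).
Qed.

Lemma filt_wordX1 s p u : filt s u -> filt (size p + s) (word X1 p u).
Proof. by move=> hu; elim: p => //= i p IH; apply: filt_X1. Qed.

Lemma filt_mono s s' u : (s <= s')%N -> filt s u -> filt s' u.
Proof.
move=> hs; apply: lin_span_min => // _ [r [p [q [h ->]]]]; apply: lin_span_base.
by exists r, p, q; split=> //; apply: leq_trans hs.
Qed.

Lemma odd_span_filt a b s u : (a + b < s)%N -> odd_span a b u -> filt s u.
Proof.
move=> hs; apply: lin_span_min => // _ [p [q [hp hq ->]]]; apply: lin_span_base.
by exists [::], p, q; rewrite hp hq.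
Qed.

(** Passing an [x1] leaves an [x3], which either kills the rest or consumes a [y3], so two odd
    factors disappear. Once no [x1] remains, passing a [y3] leaves a [y1], which kills the rest. *)
Lemma odd_span_X2 a b i u : odd_span a b u -> filt (a + b) (X2 i u).
Proof.
elim: a i u => [|a IH] i u; first by move/odd_span_X2_0 ->; apply: submod0.
move: u; apply: odd_span_indX => [|j u hu]; first exact: submod_preim.
rewrite (X2X1 oR); apply: submodB => //; first by apply: filt_X1; apply: IH.
case: b hu {IH} => [|b] hu; first by rewrite (odd_span_X3_0 _ hu); apply: submod0.
by apply: odd_span_filt (odd_span_X3 _ hu); rewrite addnS.
Qed.

Lemma filt_H2 s i u : filt s u -> filt s (H2 i u).
Proof.
move: u; apply: filt_ind => [|r a b e hs he]; first exact: submod_preim.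
elim: r => [|j r IH] /=; first by apply: odd_span_filt hs _; apply: odd_span_H2.
rewrite (H2Y2 oR); apply: submodB => //; first exact: filt_Y2.
by apply: submodMn => //; apply/filt_Y2/filt_word/(odd_span_filt hs).
Qed.

Lemma filt_X2 s i u : filt s u -> filt s (X2 i u).
Proof.
move: u; apply: filt_ind => [|r a b e hs he]; first exact: submod_preim.
elim: r => [|j r IH] /=; first by apply: (filt_mono (ltnW hs)); apply: odd_span_X2.
rewrite (X2Y2 oR); apply: submodD => //; first exact: filt_Y2.
by apply/filt_H2/filt_word/(odd_span_filt hs).
Qed.

(** [y2] commutes with [x1] and [y3], so the power reaches [w]. This crude bound starts the descent
    from n to n - (a + b). *)
Lemma odd_span_Y2_nilp a b k e : odd_span a b e -> (n < k)%N ->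
  word Y2 (nseq k 0%N) e = 0.
Proof.
move=> he hk; have hS := submod_preim (word Y2 (nseq k 0%N)) (submod_zero M).
move: e he; apply: (lin_span_min hS) => _ [p [q [_ _ ->]]].
change (word Y2 (nseq k 0%N) (word X1 p (word Y3 q w)) = 0).
rewrite (word_comm (f := word Y2 (nseq k 0%N))) => [|a1 u].
  rewrite (word_comm (f := word Y2 (nseq k 0%N))) => [|a1 u].
    by rewrite -(subnK hk) nseqD word_cat (hw_Y2 hw) !linear0.
  by elim: (nseq _ _) => //= c t ->; rewrite (Y2Y3 oR).
by elim: (nseq _ _) => //= c t ->; rewrite (Y2X1 oR).
Qed.

(* [x2 y2^(k+1) e = (k+1)(lambda - k) y2^k e] modulo [F], with [lambda = n - d]. *)
Lemma Y2_nilp_weight (F : M -> Prop) d e :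
  submod F -> (forall i u, F u -> F (Y2 i u)) -> (forall i u, F u -> F (X2 i u)) ->
  (forall i, F (X2 i e)) -> H2 0%N e = (n%:R - d%:R) *: e ->
  (forall k, (n < k)%N -> F (word Y2 (nseq k 0%N) e)) ->
  forall k, (n - d < k)%N -> F (word Y2 (nseq k 0%N) e).
Proof.
move=> hF FY FX Fe He hn k hk.
have hH k' : H2 0%N (word Y2 (nseq k' 0%N) e) =
    (n%:R - d%:R - (k' * 2)%:R) *: word Y2 (nseq k' 0%N) e.
  elim: k' => [|k' IH] /=; first by rewrite He subr0.
  rewrite (H2Y2 oR) IH linearZ /= -[_ *+ 2]scaler_nat -scalerBl mulSn natrD.
  by congr (_ *: _); ring.
have hX k' : X2 0%N (word Y2 (nseq k'.+1 0%N) e) - word Y2 (nseq k'.+1 0%N) (X2 0%N e) =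
    (k'.+1%:R * (n%:R - d%:R - k'%:R)) *: word Y2 (nseq k' 0%N) e.
  elim: k' => [|k' IH]; first by rewrite /= (X2Y2 oR) addrC addKr mul1r subr0.
  pose P := word Y2 (nseq k'.+1 0%N).
  rewrite -[word Y2 (nseq k'.+2 0%N) e]/(Y2 0%N (P e)).
  rewrite -[word Y2 (nseq k'.+2 0%N) (X2 0%N e)]/(Y2 0%N (P (X2 0%N e))).
  rewrite (X2Y2 oR) addrAC -linearB IH linearZ hH.
  rewrite -[Y2 0%N (word Y2 _ e)]/(P e) -scalerDl.
  by congr (_ *: _); rewrite -!natr1 natrM -natr1; ring.
have FYw r u : F u -> F (word Y2 r u) by move=> hu; elim: r => //= i r; apply: FY.
(* Descending induction on k from k > n. For n - d < k <= n, the coefficient (k+1)(k+d-n) is a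
   positive integer. *)
have [m] := ubnP (n.+1 - k); elim: m k hk => // m IH k hk hm.
have [/hn //|hkn] := ltnP n k.
have h1 : F (word Y2 (nseq k.+1 0%N) e) by apply: IH; lia.
have := submodB hF (FX 0%N _ h1) (FYw (nseq k.+1 0%N) _ (Fe 0%N)).
rewrite hX => /(submodZ (-1) hF); rewrite scalerA mulrCA.
have -> : -1 * (n%:R - d%:R - k%:R) = (k + d - n)%:R :> A.
  by rewrite natrB ?natrD; [ring|lia].
have [c ->] : exists c, (k + d - n = c.+1)%N by exists (k + d - n).-1; lia.
by rewrite -natrM scaler_nat mulSn addSn; apply: submod_divn.
Qed.

Lemma odd_span_Y2_filt a b k e : odd_span a b e -> (n - (a + b) < k)%N ->
  filt (a + b) (word Y2 (nseq k 0%N) e).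
Proof.
move=> he; apply: Y2_nilp_weight => //.
- by move=> i u; apply: filt_Y2.
- by move=> i u; apply: filt_X2.
- by move=> i; apply: odd_span_X2.
- exact: odd_span_weight.
- by move=> k' hk'; rewrite (odd_span_Y2_nilp he hk'); apply: submod0.
Qed.

Lemma odd_span_Y2_zero b k e : odd_span 0 b e -> (n - b < k)%N ->
  word Y2 (nseq k 0%N) e = 0.
Proof.
move=> he; apply: (Y2_nilp_weight (F := fun u => u = 0)); first exact: submod_zero.
- by move=> i u ->; rewrite linear0.
- by move=> i u ->; rewrite linear0.
- by move=> i; apply: odd_span_X2_0 he.
- exact: odd_span_weight he.
- by move=> k' hk'; apply: odd_span_Y2_nilp he hk'.
Qed.

(** Words of length 1 in [sl2_word_mem]. Without [x1] factors the vectors are genuinely killed by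
    [x2], so [F] may be taken to be zero. The form with an arbitrary [B] allows pulling back along
    [y1] and [x3]. *)
Lemma Y2_mem b (B : M -> Prop) : submod B ->
  (forall i e, (i < n - b)%N -> odd_span 0 b e -> B (Y2 i e)) ->
  forall i e, odd_span 0 b e -> B (Y2 i e).
Proof.
move=> hB h i e he.
apply: (@sl2_word_mem A M A_nat Y2 H2 X2 (Y2Y2 oR) (H2Y2 oR) (X2Y2 oR) (odd_span 0 b)
  (fun u => u = 0) (n - b)%N _ _ _ _ _ _ B 1%N hB _ _ [:: i] e erefl he).
- by move=> j u ->; rewrite linear0.
- by move=> j u ->; rewrite linear0.
- by move=> j u ->; rewrite linear0.
- by move=> j u; apply: odd_span_H2.
- by move=> j u; apply: odd_span_X2_0.
- by move=> k u; apply: odd_span_Y2_zero.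
- by move=> u ->; apply: submod0.
- by move=> [|j []] //= v _; rewrite andbT subn1 => hj hv; apply: h.
Qed.

(** The bracket of [y1] with y2 t^i is -y3 t^i, and [y1] kills [w]. Each [y3] can be moved next to
    [w] up to sign, so the bound is that of weight n whatever the number of [y3] factors. *)
Lemma wordY3_mem b (B : M -> Prop) : submod B ->
  (forall q, size q = b -> all (fun i => i < n)%N q -> B (word Y3 q w)) ->
  forall q, size q = b -> B (word Y3 q w).
Proof.
move=> hB hbase q hq.
apply: (word_anti_reduce (Y3Y3 oR) (E := odd_span 0 0) (F := fun u => u = 0) (L := n) (a := b) _ hB) => //; last first.
- exact: (odd_span_word [::] [::]).
- by move=> t u _ ->; rewrite linear0; apply: submod0.
- move=> p e hb hp; move: e; apply: odd_span_ind0; last exact: hbase.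
  exact: (submod_preim (word Y3 p) hB).
move=> B' hB' hB'1 _ i e he.
have := fun h => Y2_mem (submod_preim (Y1 0%N) hB') h i he.
rewrite (Y1Y2 oR) (odd_span_Y1 _ he) linear0 sub0r => h.
rewrite -[Y3 i e]opprK; apply: submodN => //; apply: h => j e'; rewrite subn0 => hj he'.
rewrite (Y1Y2 oR) (odd_span_Y1 _ he') linear0 sub0r; apply: submodN => //; exact: hB'1.
Qed.

(** The bracket of [x3] with y2 t^i is x1 t^i, and [x3] removes an odd factor from the vector it
    meets. That vector already carries b factors [y3], hence the bound n - b. *)
Lemma wordX1_mem a b (B : M -> Prop) : submod B -> (forall u, filt (a + b).-1 u -> B u) ->
  (forall p e, size p = a -> all (fun i => i < n - b)%N p -> odd_span 0 b e -> B (word X1 p e)) ->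
  forall p e, size p = a -> odd_span 0 b e -> B (word X1 p e).
Proof.
move=> hB hF hbase p e hp he.
case: a hp hF hbase => [|a] hp hF hbase; first by rewrite (size0nil hp); apply: (hbase [::]).
apply: (word_anti_reduce (X1X1 oR) (E := odd_span 0 b) (F := filt b) (L := (n - b)%N) (a := a.+1) _ hB) => //; last first.
  by move=> t u /= ht hu; apply: hF; rewrite addSn /= -ht; apply: filt_wordX1.
move=> B' hB' hB'1 hB'2 i {}e {}he.
have hX3 j e' : odd_span 0 b e' -> B' (Y2 j (X3 0%N e')).
  case: b {hF hbase he hB'1} hB'2 => [|b] hB'2 he'; first by rewrite (odd_span_X3_0 _ he') linear0; apply: submod0.
  by apply: hB'2; apply: filt_Y2; apply: odd_span_filt (odd_span_X3 _ he').
have := fun h => Y2_mem (submod_preim (X3 0%N) hB') h i he.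
rewrite (X3Y2 oR) => h; apply: (submod_addKr hB' _ (hX3 i e he)); apply: h => j e' hj he'.
by rewrite (X3Y2 oR); apply: submodD => //; [apply: hX3|apply: hB'1].
Qed.

(** Within a fixed number of odd factors, [y2] is reduced first, then [x1], then [y3]. Each
    reduction may alter the exponents to its right but leaves those to its left alone. Terms with
    fewer odd factors go to the outer induction. *)
Lemma monomial_mem (B : M -> Prop) : submod B ->
  (forall r p q, uniq p -> uniq q -> all (fun i => i < n - size q)%N p ->
     all (fun i => i < n)%N q ->
     all (fun i => i < (n - (size p + size q)).+1 - size r)%N r -> B (monomial r p q)) ->
  forall r p q, B (monomial r p q).
Proof.
move=> hB hbase; suff key s u : filt s u -> B u.
  by move=> r p q; apply: (key (size p + size q).+1); apply: lin_span_base; exists r, p, q.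
elim: s u => [|s IH]; apply: lin_span_min => // _ [r [p [q [hs ->]]]] //.
move: hs; rewrite ltnS leq_eqVlt => /orP[/eqP hs|hs]; last first.
  by apply: IH; apply: lin_span_base; exists r, p, q.
set a := size p; set b := size q.
rewrite /monomial; have he := odd_span_word p q.
apply: (@sl2_word_mem A M A_nat Y2 H2 X2 (Y2Y2 oR) (H2Y2 oR) (X2Y2 oR) (odd_span a b)
  (filt s) (n - s)%N _ _ _ _ _ _ B (size r) hB _ _ r _ erefl he) => //.
- by move=> i u; apply: filt_Y2.
- by move=> i u; apply: filt_H2.
- by move=> i u; apply: filt_X2.
- by move=> i u; apply: odd_span_H2.
- by move=> i u; rewrite -hs; apply: odd_span_X2.
- by move=> k u; rewrite -hs; apply: odd_span_Y2_filt.
move=> {he} t e ht hbox; move: e.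
have hBt := submod_preim (word Y2 t) hB.
apply: (lin_span_min hBt) => _ [p' [q' [hp' hq' ->]]].
apply: (wordX1_mem (a := a) (b := b) hBt) => //.
- move=> u hu; apply: IH; apply: filt_word; apply: filt_mono hu.
  by rewrite -hs leq_pred.
- move=> p1 e hp1 hall he; move: he hall.
  have hB1 := submod_preim (word X1 p1) hBt.
  move=> he hall; move: e he; apply: (lin_span_min hB1) => _ [p2 [q2 [/size0nil -> hq2 ->]]] /=.
  apply: (wordY3_mem hB1 _ hq2) => q3 hq3 hall3.
  change (B (word Y2 t (word X1 p1 (word Y3 q3 w)))).
  case: (boolP (uniq p1)) => u1; last first.
    by rewrite (word_anti_nuniq A_nat (X1X1 oR) _ u1) linear0; apply: submod0.
  case: (boolP (uniq q3)) => u3; last first.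
    by rewrite (word_anti_nuniq A_nat (Y3Y3 oR) _ u3) !linear0; apply: submod0.
  by apply: hbase; rewrite // ?hq3 // hp1 -/a -/b hs ht.
- by rewrite -hq'; apply: (odd_span_word [::]).
Qed.

Lemma monomial_span_ind (S : M -> Prop) : submod S ->
  (forall r a b e, odd_span a b e -> S (word Y2 r e)) -> forall u, monomial_span u -> S u.
Proof.
move=> hS h; apply: lin_span_min => // _ [r [p [q ->]]]; apply: h; exact: odd_span_word.
Qed.

Lemma odd_span_monomial a b u : odd_span a b u -> monomial_span u.
Proof. by apply: lin_span_min => // _ [p [q [_ _ ->]]]; apply: lin_span_base; exists [::], p, q. Qed.

Lemma filt_monomial s u : filt s u -> monomial_span u.
Proof. by apply: lin_span_min => // _ [r [p [q [_ ->]]]]; apply: lin_span_base; exists r, p, q. Qed.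

Lemma monomial_span_w : monomial_span w.
Proof. by apply: lin_span_base; exists [::], [::], [::]. Qed.

Lemma monomial_span_Y2 i u : monomial_span u -> monomial_span (Y2 i u).
Proof.
move: u; apply: lin_span_min; first exact: submod_preim.
by move=> _ [r [p [q ->]]]; apply: lin_span_base; exists (i :: r), p, q.
Qed.

Lemma monomial_span_X1 i u : monomial_span u -> monomial_span (X1 i u).
Proof.
move: u; apply: lin_span_min; first exact: submod_preim.
move=> _ [r [p [q ->]]]; apply: lin_span_base; exists r, (i :: p), q.
by rewrite /monomial (word_comm (f := X1 i)) // => a u; rewrite (Y2X1 oR).
Qed.

Lemma monomial_span_word r a b e : odd_span a b e -> monomial_span (word Y2 r e).
Proof.
by move/odd_span_monomial=> he; elim: r => //= i r IH; apply: monomial_span_Y2.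
Qed.

Lemma monomial_span_Y3 i u : monomial_span u -> monomial_span (Y3 i u).
Proof.
move: u; apply: monomial_span_ind => [|r a b e]; first exact: submod_preim.
rewrite (word_comm (f := Y3 i)) => [he|j u]; last by rewrite (Y2Y3 oR).
suff : monomial_span (Y3 i e) by move=> h; elim: r => //= j r IH; apply: monomial_span_Y2.
elim: a i e he => [|a IH] i e; first by move/odd_span_Y3/odd_span_monomial.
move: e; apply: odd_span_indX => [|j u hu]; first exact: submod_preim.
rewrite (Y3X1 oR); apply: submodD => //.
  by apply: submodN => //; apply: monomial_span_X1; apply: IH.
by apply: monomial_span_Y2; apply: odd_span_monomial hu.
Qed.

Lemma monomial_span_H1 i u : monomial_span u -> monomial_span (H1 i u).
Proof.
move: u; apply: monomial_span_ind => [|r a b e he]; first exact: submod_preim.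
elim: r => [|j r IH] /=; first by apply: odd_span_monomial (odd_span_H1 _ he).
rewrite (H1Y2 oR); apply: submodB => //; apply: monomial_span_Y2 => //.
exact: monomial_span_word he.
Qed.

Lemma monomial_span_H2 i u : monomial_span u -> monomial_span (H2 i u).
Proof.
move: u; apply: monomial_span_ind => [|r a b e he]; first exact: submod_preim.
elim: r => [|j r IH] /=; first by apply: odd_span_monomial (odd_span_H2 _ he).
rewrite (H2Y2 oR); apply: submodB => //; first exact: monomial_span_Y2.
by apply: submodMn => //; apply: monomial_span_Y2; apply: monomial_span_word he.
Qed.

Lemma monomial_span_X2 i u : monomial_span u -> monomial_span (X2 i u).
Proof.
move: u; apply: monomial_span_ind => [|r a b e he]; first exact: submod_preim.
elim: r => [|j r IH] /=; first by apply: filt_monomial (odd_span_X2 _ he).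
rewrite (X2Y2 oR); apply: submodD => //; first exact: monomial_span_Y2.
by apply: monomial_span_H2; apply: monomial_span_word he.
Qed.

Lemma monomial_span_X3 i u : monomial_span u -> monomial_span (X3 i u).
Proof.
move: u; apply: monomial_span_ind => [|r a b e he]; first exact: submod_preim.
elim: r => [|j r IH] /=.
  case: b he => [|b] he; first by rewrite (odd_span_X3_0 _ he); apply: submod0.
  by apply: odd_span_monomial (odd_span_X3 _ he).
rewrite (X3Y2 oR); apply: submodD => //; first exact: monomial_span_Y2.
by apply: monomial_span_X1; apply: monomial_span_word he.
Qed.

Lemma monomial_span_Y1 i u : monomial_span u -> monomial_span (Y1 i u).
Proof.
move: u; apply: monomial_span_ind => [|r a b e he]; first exact: submod_preim.
elim: r => [|j r IH] /=; last first.
  rewrite (Y1Y2 oR); apply: submodB => //; first exact: monomial_span_Y2.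
  by apply: monomial_span_Y3; apply: monomial_span_word he.
elim: a i e he => [|a IH] i e; first by move/odd_span_Y1 ->; apply: submod0.
move: e; apply: odd_span_indX => [|j u hu]; first exact: submod_preim.
rewrite (Y1X1 oR); apply: submodD => //.
  by apply: submodN => //; apply: monomial_span_X1; apply: IH.
by apply: odd_span_monomial (odd_span_H1 _ hu).
Qed.

End Spanning.

(** * Super POPs *)

Section SuperPOPs.
Variable n : nat.
Local Notation pops := ('M[bool]_(2, n) * (nat * seq nat))%type.

Definition even_exps N (mp : nat * seq nat) : seq nat :=
  nseq (N - mp.1 - size mp.2) 0%N ++ flatten [seq nseq (count_mem k mp.2) k | k <- iota 1 mp.1].

Definition row_exps (A : 'M[bool]_(2, n)) (i : 'I_2) : seq nat :=
  [seq val j | j <- enum 'I_n & A i j].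

Definition x1_row : 'I_2 := @Ordinal 2 0 isT.
Definition y3_row : 'I_2 := @Ordinal 2 1 isT.

Lemma sA_rows (A : 'M[bool]_(2, n)) : sA A = (size (row_exps A x1_row) + size (row_exps A y3_row))%N.
Proof.
have row i : (\sum_(j < n) A i j)%N = size (row_exps A i).
  rewrite size_map size_filter -sum1_count big_enum_cond [LHS](bigID (A i)) /=.
  by rewrite [X in (_ + X)%N]big1 ?addn0 => [|j /negPf -> //]; apply: eq_bigr => j ->.
rewrite /sA big_ord_recr big_ord1 /= !row; congr (size (row_exps A _) + size (row_exps A _))%N.
all: exact: val_inj.
Qed.

Lemma sA2_row (A : 'M[bool]_(2, n)) : sA2 A = size (row_exps A y3_row).
Proof.
rewrite size_map size_filter -sum1_count big_enum_cond /sA2 [LHS](bigID (A y3_row)) /=.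
by rewrite [X in (_ + X)%N]big1 ?addn0 => [|j /negPf -> //]; apply: eq_bigr => j ->.
Qed.

Lemma mem_row_exps A i j : (j \in row_exps A i) = [exists k : 'I_n, (val k == j) && A i k].
Proof.
apply/mapP/existsP => [[k + ->]|[k /andP[/eqP <- hk]]].
  by rewrite mem_filter => /andP[hk _]; exists k; rewrite eqxx.
by exists k => //; rewrite mem_filter hk mem_enum.
Qed.

Lemma row_exps_uniq A i : uniq (row_exps A i).
Proof. by rewrite map_inj_uniq; [rewrite filter_uniq ?enum_uniq|exact: val_inj]. Qed.

Lemma perm_flatten_count (s u : seq nat) : uniq u ->
  perm_eq (flatten [seq nseq (count_mem k s) k | k <- u]) [seq x <- s | x \in u].
Proof.
elim: u => [|k u IH] /=; first by move=> _; rewrite (eq_filter (a2 := pred0)) ?filter_pred0.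
move=> /andP[hk /IH hu].
rewrite (permPr (_ : perm_eq _ ([seq x <- s | x == k] ++ [seq x <- s | x \in u]))).
  rewrite perm_cat // -size_filter.
  have: all (pred1 k) [seq x <- s | pred1 k x] by exact: filter_all.
  by move/all_pred1P=> <-.
rewrite -(perm_filterC (pred1 k)) -!filter_predI.
rewrite (@eq_filter _ (predI (pred1 k) _) (pred1 k)) => [|x /=]; last first.
  by rewrite inE; case: eqP.
rewrite (@eq_filter _ (predI (predC (pred1 k)) _) (mem u)) // => x /=.
by rewrite inE; case: eqP => //= ->; rewrite (negPf hk).
Qed.

(** The bounds of [monomial_mem] translate into those of a super POP. With N = n - s(A) the middle
    entry is N - size r, so that the number of [y2] factors is N minus the middle entry. The
    positive exponents are the parts, and zero exponents account for missing parts. *)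
Lemma superPOP_exists r p q :
  uniq p -> uniq q -> all (fun i => i < n - size q)%N p -> all (fun i => i < n)%N q ->
  all (fun i => i < (n - (size p + size q)).+1 - size r)%N r ->
  exists P : pops, [/\ superPOP P, perm_eq (even_exps (n - sA P.1) P.2) r,
    perm_eq (row_exps P.1 x1_row) p & perm_eq (row_exps P.1 y3_row) q].
Proof.
move=> up uq hp hq hr.
pose A : 'M[bool]_(2, n) := \matrix_(i, j) if i == x1_row then val j \in p else val j \in q.
have hqn : (size q <= n)%N.
  by rewrite -[n](size_iota 0); apply: uniq_leq_size => // i /(allP hq); rewrite mem_iota add0n.
have hpn : (size p <= n - size q)%N.
  by rewrite -[X in (_ <= X)%N](size_iota 0); apply: uniq_leq_size => // i /(allP hp); rewrite mem_iota add0n.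
have perm_p : perm_eq (row_exps A x1_row) p.
  apply: uniq_perm; [exact: row_exps_uniq|exact: up|move=> j]; rewrite mem_row_exps.
  apply/existsP/idP => [[k /andP[/eqP <-]]|hj]; first by rewrite mxE eqxx.
  have hjn : (j < n)%N by apply: leq_trans (allP hp _ hj) (leq_subr _ _).
  by exists (Ordinal hjn); rewrite mxE !eqxx.
have perm_q : perm_eq (row_exps A y3_row) q.
  apply: uniq_perm; [exact: row_exps_uniq|exact: uq|move=> j]; rewrite mem_row_exps.
  apply/existsP/idP => [[k /andP[/eqP <-]]|hj]; first by rewrite mxE.
  have hjn : (j < n)%N := allP hq _ hj.
  by exists (Ordinal hjn); rewrite mxE !eqxx.
have hsA : sA A = (size p + size q)%N by rewrite sA_rows (perm_size perm_p) (perm_size perm_q).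
set N := (n - (size p + size q))%N in hr.
have hrN : (size r <= N)%N.
  by case: r hr => // a r /andP[+ _]; rewrite /=; lia.
pose pi := sort geq [seq x <- r | (0 < x)%N].
exists (A, (N - size r, pi)%N); split=> //=; last first.
- rewrite hsA -/N /even_exps /= size_sort size_filter.
  rewrite (permPl (_ : perm_eq _ (nseq (count_mem 0%N r) 0%N ++ [seq x <- r | (0 < x)%N]))).
    have: all (pred1 0%N) [seq x <- r | pred1 0%N x] by exact: filter_all.
    move/all_pred1P; rewrite size_filter => <-.
    rewrite perm_sym (permPr (_ : perm_eq _ ([seq x <- r | (0 < x)%N] ++ [seq x <- r | ~~ (0 < x)%N]))).
      by rewrite perm_sym perm_filterC.
    by rewrite perm_catC; apply/permPl; rewrite (eq_filter (a1 := pred1 0%N) (a2 := fun x => ~~ (0 < x)%N)) // => x /=; rewrite -eqn0Ngt.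
  have -> : (N - (N - size r) - count (fun x => (0 < x)%N) r = count_mem 0%N r)%N.
    rewrite subKn // -(count_predC (pred1 0%N) r) (eq_count (a1 := fun x => (0 < x)%N) (a2 := predC (pred1 0%N))) ?addnK //.
    by move=> x /=; rewrite lt0n.
  rewrite perm_cat2l (permPl (perm_flatten_count _ (iota_uniq _ _))).
  rewrite (permPl (_ : perm_eq _ pi)) ?perm_sort //.
  rewrite (_ : filter _ _ = pi) //; apply/all_filterP/allP => x.
  rewrite mem_sort mem_filter mem_iota => /andP[x0 /(allP hr) /=]; lia.
apply/and3P; split=> /=.
- apply/forallP => j; apply/implyP; rewrite sA2_row (perm_size perm_q) /= mxE /= => hj.
  apply/negP => hjp; have /= := allP hp _ hjp; lia.
- by rewrite hsA; lia.
rewrite hsA -/N; apply/and4P; split=> /=.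
- by rewrite leq_subr.
- by rewrite size_sort size_filter subKn // count_size.
- apply/allP => x; rewrite mem_sort mem_filter => /andP[-> /(allP hr) /=]; lia.
- by apply: sort_sorted => x y; rewrite /geq /= leq_total.
Qed.

(* Lattice word of a partition: its parts count the [true]s after each [false]. *)
Fixpoint lattice_parts (l : seq bool) : seq nat :=
  match l with
  | [::] => [::]
  | true :: l' => lattice_parts l'
  | false :: l' => count id l' :: lattice_parts l'
  end.

(** If the largest part equals the number [m] of [true]s still to be placed, the word begins with
    [false], otherwise with [true]. *)
Lemma lattice_parts_surj m rho : sorted geq rho -> all (fun k => k <= m)%N rho ->
  exists l, [/\ size l = (m + size rho)%N, count id l = m & lattice_parts l = rho].
Proof.
have [N] := ubnP (m + size rho); elim: N m rho => // N IH m rho hN hs hm.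
case: rho hN hs hm => [|k rho] hN hs hm.
  exists (nseq m true); rewrite size_nseq count_nseq mul1n addn0; split=> //.
  by elim: m {hN hm}.
have [hkm|hkm] := eqVneq k m.
  have [l [h1 h2 h3]] := IH m rho ltac:(by move: hN => /=; lia) (path_sorted hs)
    ltac:(by case/andP: hm).
  by exists (false :: l); rewrite /= h1 h2 h3 hkm addnS.
have hlt : (k < m)%N by rewrite ltn_neqAle hkm; case/andP: hm.
case: m hlt hN hm {hkm} => // m hlt hN hm.
have hall : all (fun i => i <= m)%N (k :: rho).
  have gtr : transitive geq by move=> x y z /= h h'; apply: leq_trans h' h.
  rewrite /= -ltnS hlt; apply/allP => i hi.
  have /allP/(_ _ hi) /= hik := order_path_min gtr hs.
  by apply: leq_trans hik _; rewrite -ltnS.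
have [l [h1 h2 h3]] := IH m (k :: rho) ltac:(by move: hN => /=; lia) hs hall.
by exists (true :: l); rewrite /= h1 h2 h3.
Qed.

(** The positions of the deleted letters and the word that remains can be prescribed independently,
    provided the lengths match. *)
Lemma unfilter (T : Type) (mask : seq bool) (u : seq T) : size u = count negb mask ->
  exists c : seq (option T), [/\ size c = size mask, [seq ~~ isSome x | x <- c] = mask
    & pmap id c = u].
Proof.
elim: mask u => [|[] mask IH] u hu; first by exists [::]; rewrite (size0nil hu).
  by have [c [h1 h2 h3]] := IH u hu; exists (None :: c); rewrite /= h1 h2.
case: u hu => // x u [hu]; have [c [h1 h2 h3]] := IH u hu.
by exists (Some x :: c); rewrite /= h1 h2 h3.
Qed.

(** Four letters, hence the bound 4^n. [None] marks the 1s of the [y3] row. In the word left after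
    deleting these, [Some None] marks the 1s of the [x1] row, which are thereby confined to the
    first n - sA2 columns as in [in_S]. The remaining booleans form the lattice path of the POP. *)
Definition pop_of_word (c : seq (option (option bool))) : pops :=
  let c' := pmap id c in
  let c'' := pmap id c' in
  (\matrix_(i, j) (if i == x1_row then nth false [seq ~~ isSome x | x <- c'] j
                   else nth false [seq ~~ isSome x | x <- c] j),
   (count id c'', [seq k <- lattice_parts c'' | (0 < k)%N])).

Lemma pop_of_word_surj P : superPOP P -> exists c : n.-tuple (option (option bool)), pop_of_word c = P.
Proof.
case: P => A [m pi] /and3P[/forallP /= hS hA /and4P[/= hm hsz hall hsort]].
rewrite subn0 in hall.
set N := (n - sA A)%N in hm hsz.
have [c'' [h1 h2 h3]] : exists l, [/\ size l = N, count id l = m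
    & [seq k <- lattice_parts l | (0 < k)%N] = pi].
  pose rho := pi ++ nseq (N - m - size pi) 0%N.
  have [||l [h1 h2 h3]] := @lattice_parts_surj m rho.
  - have gtr : transitive geq by move=> x y z /= h h'; apply: leq_trans h' h.
    rewrite (sorted_pairwise gtr) pairwise_cat -(sorted_pairwise gtr) hsort /=.
    apply/andP; split; first by apply/allrelP => x y _ /nseqP[-> _].
    elim: (N - m - size pi)%N => //= k ->; rewrite andbT.
    by apply/allP => y /nseqP[-> _].
  - rewrite all_cat; apply/andP; split; first by apply/allP => x /(allP hall)/andP[].
    by apply/allP => x /nseqP[-> _].
  exists l; split=> //; first by rewrite h1 size_cat size_nseq; lia.
  rewrite h3 filter_cat (@eq_in_filter _ _ predT pi) => [|x /(allP hall)/andP[]//].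
  by rewrite filter_predT; elim: (N - m - _)%N => [|k IH] //=; rewrite cats0.
pose r1 := [seq A x1_row j | j <- enum 'I_n]; pose r2 := [seq A y3_row j | j <- enum 'I_n].
have sz i : size [seq A i j | j <- enum 'I_n] = n by rewrite size_map size_enum_ord.
have cnt i : count id [seq A i j | j <- enum 'I_n] = size (row_exps A i).
  by rewrite count_map size_map size_filter.
have nth_row i (j : 'I_n) : nth false [seq A i j | j <- enum 'I_n] j = A i j.
  by rewrite (nth_map j) ?size_enum_ord // nth_ord_enum.
set b := size (row_exps A y3_row) in cnt *.
have hb : (b <= n)%N by rewrite /b -cnt -[X in (_ <= X)%N](sz y3_row) count_size.
have hdrop : all (fun x => ~~ x) (drop (n - b) r1).
  apply/(all_nthP false) => j; rewrite size_drop sz nth_drop => hj.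
  have hj' : (n - b + j < n)%N by lia.
  rewrite (nth_row x1_row (Ordinal hj')).
  have := hS (Ordinal hj'); rewrite sA2_row -/b /= => /implyP; apply; lia.
have hcnt1 : count id (take (n - b) r1) = size (row_exps A x1_row).
  rewrite -cnt -/r1 -[in RHS](cat_take_drop (n - b) r1) count_cat.
  by rewrite [X in _ = (_ + X)%N](_ : _ = 0%N) ?addn0 //; apply/eqP; rewrite -leqn0 leqNgt -has_count -all_predC.
have hsA := sA_rows A.
have [c' [g1 g2 g3]] : exists c : seq (option bool), [/\ size c = (n - b)%N,
    [seq ~~ isSome x | x <- c] = take (n - b) r1 & pmap id c = c''].
  have [|c [g1 g2 g3]] := @unfilter bool (take (n - b) r1) c''.
    have := count_predC id (take (n - b) r1); rewrite size_take sz hcnt1 h1 /N hsA -/b.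
    by have -> : count (predC id) (take (n - b) r1) = count negb (take (n - b) r1) by []; case: ifP; lia.
  by exists c; split=> //; rewrite g1 size_take sz; case: ifP; lia.
have [c [f1 f2 f3]] : exists c : seq (option (option bool)), [/\ size c = n,
    [seq ~~ isSome x | x <- c] = r2 & pmap id c = c'].
  have [|c [f1 f2 f3]] := @unfilter _ r2 c'.
    have := count_predC id r2; rewrite sz cnt g1 -/b.
    by have -> : count (predC id) r2 = count negb r2 by []; lia.
  by exists c; rewrite f1 sz.
exists (Tuple (introT eqP f1)); rewrite /pop_of_word /= f3 g3 g2 f2 h2 h3; congr (_, _).
apply/matrixP => i j; rewrite mxE; case: eqP => [->|hi]; last first.
  rewrite nth_row; congr (A _ j); apply: val_inj.
  by case: i hi => -[|[|//]] hi /=; [case; apply: val_inj|].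
rewrite -[RHS](nth_row x1_row) -/r1.
have [hj|hj] := ltnP j (n - b); first by rewrite nth_take.
(* Past n - b the default [false] is the vanishing that [in_S] demands. *)
rewrite nth_default ?size_take ?sz; last by case: ifP; lia.
move: hdrop => /(all_nthP false) /(_ (j - (n - b))%N).
by rewrite size_drop sz nth_drop subnKC // => h; apply/esym/negbTE/h; have := ltn_ord j; lia.
Qed.

Lemma superPOP_enum : exists dec : 'I_(4 ^ n) -> pops, forall P, superPOP P -> exists i, dec i = P.
Proof.
have card4 : #|{: n.-tuple (option (option bool))}| = (4 ^ n)%N.
  by rewrite card_tuple !card_option card_bool.
exists (fun i => pop_of_word (enum_val (cast_ord (esym card4) i))) => P hP.
have [c hc] := pop_of_word_surj hP; exists (cast_ord card4 (enum_rank c)).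
by rewrite cast_ordK enum_rankK.
Qed.

End SuperPOPs.

Section SuperPOPSpan.
Variables (A : comUnitRingType) (M : lmodType A).
Hypothesis A_nat : invertible_nats A.
Variables (o : sl12_ops M) (psi1 psi2 : nat -> A) (n : nat) (w : M).
Hypothesis oR : sl12_rel o.
Hypothesis hw : hw_vector o psi1 psi2 n w.

Definition superPOP_monomial (P : 'M[bool]_(2, n) * (nat * seq nat)) : M :=
  monomial o w (even_exps (n - sA P.1) P.2) (row_exps P.1 x1_row) (row_exps P.1 y3_row).

Lemma monomial_span_superPOP (B : M -> Prop) : submod B ->
  (forall P, superPOP P -> B (superPOP_monomial P)) -> forall u, monomial_span o w u -> B u.
Proof.
move=> hB hbase; apply: lin_span_min => // _ [r [p [q ->]]].
apply: (monomial_mem A_nat oR hw hB) => {r p q} r p q up uq hp hq hr.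
have [P [hP pr pp pq]] := superPOP_exists up uq hp hq hr.
have := hbase P hP; rewrite /superPOP_monomial /monomial.
rewrite (word_perm_invariant _ (Y2Y2 oR) pr).
have [e ->] := word_anti_perm (X1X1 oR) (word (Y3 o) (row_exps P.1 y3_row) w) pp.
have [f ->] := word_anti_perm (Y3Y3 oR) w pq.
rewrite !linearZ /= scalerA -exprD => /(submodZ ((-1) ^+ (e + f)) hB).
by rewrite scalerA -exprMn mulrNN mulr1 expr1n scale1r.
Qed.

End SuperPOPSpan.

(** * Modules over the current superalgebra *)

Section CurrentModules.
Variable A : comUnitRingType.
Local Notation mx3 := 'M[A]_3.
Local Notation E := (@delta_mx A 3 3).

(* Counterparts of [in_g], [homog], [sbr] and [is_gt_module] over a commutative ring. *)
Definition sl12_mem (X : mx3) : Prop := X o1 o1 - X o2 o2 - X o3 o3 = 0.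
Definition homogeneous (p : bool) (X : mx3) : Prop :=
  forall i j, (ipar i (+) ipar j) != p -> X i j = 0.
Definition superbracket (p q : bool) (X Y : mx3) : mx3 :=
  X *m Y - (-1) ^+ (p && q) *: (Y *m X).

Definition current_module (M : lmodType A) (act : nat -> mx3 -> M -> M) : Prop :=
  [/\ forall r X (c : A) (u v : M), act r X (c *: u + v) = c *: act r X u + act r X v,
      forall r (c : A) X Y (u : M), sl12_mem X -> sl12_mem Y ->
        act r (c *: X + Y) u = c *: act r X u + act r Y u &
      forall r s p q X Y (u : M), sl12_mem X -> sl12_mem Y ->
        homogeneous p X -> homogeneous q Y ->
        act r X (act s Y u) - (-1) ^+ (p && q) *: act s Y (act r X u) =
        act (r + s)%N (superbracket p q X Y) u].

Definition linear_op (M : lmodType A) (f : M -> M) (hf : linear f) : {linear M -> M} :=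
  HB.pack f (GRing.isLinear.Build A M M *:%R f hf).

Section Operators.
Variables (M : lmodType A) (act : nat -> mx3 -> M -> M).
Hypothesis actM : current_module act.

Let act_linear r X : linear (act r X).
Proof. by case: actM => h _ _ c u v; apply: h. Qed.

Definition ops_of : sl12_ops M :=
  let op X r := linear_op (act_linear r X) in
  Sl12Ops (op (E o1 o2)) (op (E o2 o3)) (op (E o1 o3)) (op (E o2 o1)) (op (E o3 o2))
    (op (E o3 o1)) (op (E o1 o1 + E o2 o2)) (op (E o2 o2 - E o3 o3)).

Lemma act0 r u : act r 0 u = 0.
Proof.
case: actM => _ h _; have h0 : sl12_mem 0 by rewrite /sl12_mem !mxE !subr0.
have := h r 1 0 0 u h0 h0; rewrite scaler0 add0r scale1r.
by rewrite -[X in X = _]addr0 => /addrI/esym.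
Qed.

Lemma actZ r c X u : sl12_mem X -> act r (c *: X) u = c *: act r X u.
Proof.
move=> hX; case: (actM) => _ h _; have h0 : sl12_mem 0 by rewrite /sl12_mem !mxE !subr0.
by have := h r c X 0 u hX h0; rewrite act0 !addr0.
Qed.

Lemma actD r X Y u : sl12_mem X -> sl12_mem Y -> act r (X + Y) u = act r X u + act r Y u.
Proof.
move=> hX hY; case: (actM) => _ h _.
by have := h r 1 X Y u hX hY; rewrite !scale1r.
Qed.

Lemma act_comm p q X Y Z i j u : sl12_mem X -> sl12_mem Y ->
  homogeneous p X -> homogeneous q Y -> superbracket p q X Y = Z ->
  act i X (act j Y u) = (-1) ^+ (p && q) *: act j Y (act i X u) + act (i + j)%N Z u.
Proof.
by move=> hX hY pX qY <-; case: actM => _ _ <- //; rewrite addrC subrK.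
Qed.

Lemma homogeneous_delta p i j : ipar i (+) ipar j = p -> homogeneous p (E i j).
Proof.
move=> hp k l hkl; rewrite mxE; case: (k =P i) hkl => [->|//].
by case: (l =P j) => [->|//]; rewrite hp eqxx.
Qed.

Lemma homogeneousB p X Y : homogeneous p X -> homogeneous p Y -> homogeneous p (X - Y).
Proof. by move=> hX hY i j hij; rewrite !mxE hX ?hY ?subr0. Qed.

Lemma homogeneousD p X Y : homogeneous p X -> homogeneous p Y -> homogeneous p (X + Y).
Proof. by move=> hX hY i j hij; rewrite !mxE hX ?hY ?addr0. Qed.

Lemma sl12_mem_delta i j : i != j -> sl12_mem (E i j).
Proof.
move=> hij; rewrite /sl12_mem !mxE.
have off (k : 'I_3) : (k == i) && (k == j) = false.
  by apply/negP => /andP[/eqP ki /eqP kj]; rewrite -ki -kj eqxx in hij.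
by rewrite !off !subr0.
Qed.

Ltac bracket := rewrite /superbracket ?mulmxDl ?mulmxDr ?mulNmx ?mulmxN ?mul0mx ?mulmx0
  ?mul_delta_mx_cond; apply/matrixP => k l; rewrite !mxE /=; ring.
Ltac homog := try apply: homogeneousB; try apply: homogeneousD; exact: homogeneous_delta.
Ltac mem := rewrite /sl12_mem !mxE /=; ring.
Ltac rel p q c W :=
  rewrite (@act_comm p q _ _ (c *: W));
  [rewrite actZ; [|mem]; rewrite /= ?expr0 ?expr1 ?scale1r ?scaleN1r ?scale0r ?addr0 //
  |mem|mem|homog|homog|bracket].

Lemma ops_of_rel : sl12_rel ops_of.
Proof.
split=> i j u /=.
- rel false false (0 : A) (0 : mx3).
- rel false true (0 : A) (0 : mx3).
- rel false true (0 : A) (0 : mx3).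
- rel true true (0 : A) (0 : mx3).
- rel true true (0 : A) (0 : mx3).
- rel true true (1 : A) (E o3 o2).
- rel false false (-1 : A) (E o3 o2).
- rel false false (-2%:R : A) (E o3 o2); by rewrite scaleNr scaler_nat.
- rel false false (1 : A) (E o2 o2 - E o3 o3).
- rel true false (1 : A) (E o1 o2).
- rel true false (-1 : A) (E o3 o1).
- rel false true (0 : A) (0 : mx3).
- rel false true (-1 : A) (E o1 o2).
- rel false true (-1 : A) (E o1 o3).
- rel true true (0 : A) (0 : mx3).
- rel true true (1 : A) (E o1 o1 + E o2 o2).
- rel false true (-1 : A) (E o3 o1).
- rel false true (-1 : A) (E o3 o1).
- rel false true (1 : A) (E o2 o1).
- rewrite -[X in _ = _ + (_ + X)]scaleN1r -actZ -?actD; [|mem..].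
  rel true true (1 : A) ((E o1 o1 + E o2 o2) + (-1) *: (E o2 o2 - E o3 o3)).
- rel true true (0 : A) (0 : mx3).
Qed.

Lemma sl12_decomp X : sl12_mem X ->
  X = X o1 o2 *: E o1 o2 + (X o2 o3 *: E o2 o3 + (X o1 o3 *: E o1 o3 + (X o2 o1 *: E o2 o1
    + (X o3 o2 *: E o3 o2 + (X o3 o1 *: E o3 o1 + (X o1 o1 *: (E o1 o1 + E o2 o2)
    + (- X o3 o3) *: (E o2 o2 - E o3 o3))))))).
Proof.
move=> hX; have h22 : X o2 o2 = X o1 o1 - X o3 o3.
  by apply/eqP; rewrite -subr_eq0; apply/eqP; rewrite -[RHS]oppr0 -hX; ring.
have e1 : ord0 = o1 by apply: val_inj.
have e2 : lift ord0 ord0 = o2 by apply: val_inj.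
have e3 : lift ord0 (lift ord0 ord0) = o3 by apply: val_inj.
rewrite [LHS]matrix_sum_delta !big_ord_recl !big_ord0 e3 e2 e1 h22.
by apply/matrixP => k l; rewrite !mxE; ring.
Qed.

Lemma sl12_memD X Y : sl12_mem X -> sl12_mem Y -> sl12_mem (X + Y).
Proof.
rewrite /sl12_mem => hX hY; rewrite !mxE -[RHS]addr0 -[X in _ = X + _]hX -[X in _ = _ + X]hY.
by ring.
Qed.

Lemma sl12_memZ c X : sl12_mem X -> sl12_mem (c *: X).
Proof. by rewrite /sl12_mem => hX; rewrite !mxE -!mulrBr hX mulr0. Qed.

Lemma act_closed (B : M -> Prop) : submod B ->
  (forall i u, B u -> B (X1 ops_of i u)) -> (forall i u, B u -> B (X2 ops_of i u)) ->
  (forall i u, B u -> B (X3 ops_of i u)) -> (forall i u, B u -> B (Y1 ops_of i u)) ->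
  (forall i u, B u -> B (Y2 ops_of i u)) -> (forall i u, B u -> B (Y3 ops_of i u)) ->
  (forall i u, B u -> B (H1 ops_of i u)) -> (forall i u, B u -> B (H2 ops_of i u)) ->
  forall r X u, sl12_mem X -> B u -> B (act r X u).
Proof.
move=> hB bX1 bX2 bX3 bY1 bY2 bY3 bH1 bH2 r X u hX hu; rewrite (sl12_decomp hX).
pose P V := sl12_mem V /\ B (act r V u).
have PZ c W : P W -> P (c *: W).
  by move=> [h1 h2]; split; [exact: sl12_memZ|rewrite actZ //; apply: submodZ].
have PD W V : P W -> P V -> P (W + V).
  by move=> [h1 h2] [h3 h4]; split; [exact: sl12_memD|rewrite actD //; apply: submodD].
suff [] : P (X o1 o2 *: E o1 o2 + (X o2 o3 *: E o2 o3 + (X o1 o3 *: E o1 o3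
    + (X o2 o1 *: E o2 o1 + (X o3 o2 *: E o3 o2 + (X o3 o1 *: E o3 o1
    + (X o1 o1 *: (E o1 o1 + E o2 o2) + (- X o3 o3) *: (E o2 o2 - E o3 o3)))))))) by [].
have mk W : sl12_mem W -> B (act r W u) -> P W by [].
apply: (PD); [by apply: PZ; apply: mk; [mem|exact: bX1]|].
apply: (PD); [by apply: PZ; apply: mk; [mem|exact: bX2]|].
apply: (PD); [by apply: PZ; apply: mk; [mem|exact: bX3]|].
apply: (PD); [by apply: PZ; apply: mk; [mem|exact: bY1]|].
apply: (PD); [by apply: PZ; apply: mk; [mem|exact: bY2]|].
apply: (PD); [by apply: PZ; apply: mk; [mem|exact: bY3]|].
apply: (PD); [by apply: PZ; apply: mk; [mem|exact: bH1]|].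
by apply: PZ; apply: mk; [mem|exact: bH2].
Qed.

Lemma hw_monomial_span_closed (psi1 psi2 : nat -> A) n w :
  invertible_nats A -> hw_vector ops_of psi1 psi2 n w ->
  forall r X u, sl12_mem X -> monomial_span ops_of w u -> monomial_span ops_of w (act r X u).
Proof.
move=> hA hw; have oR := ops_of_rel.
apply: act_closed; first exact: lin_span_submod.
- by move=> i u; apply: (monomial_span_X1 oR).
- by move=> i u; apply: (monomial_span_X2 oR hw).
- by move=> i u; apply: (monomial_span_X3 oR hw).
- by move=> i u; apply: (monomial_span_Y1 oR hw).
- by move=> i u; apply: (monomial_span_Y2 (o := ops_of)).
- by move=> i u; apply: (monomial_span_Y3 oR).
- by move=> i u; apply: (monomial_span_H1 oR hw).
- by move=> i u; apply: (monomial_span_H2 oR hw).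
Qed.

End Operators.
End CurrentModules.

(** * Tensor products of evaluation modules *)

Section TensorBilinear.
Variable A : comPzRingType.
Variables (m n p q : nat).
Implicit Types (X Y : 'M[A]_(m, n)) (Z T : 'M[A]_(p, q)).

Lemma tensmxDl X Y Z : (X + Y) *t Z = X *t Z + Y *t Z.
Proof. by apply/matrixP => i j; rewrite !mxE mulrDl. Qed.
Lemma tensmxDr X Z T : X *t (Z + T) = X *t Z + X *t T.
Proof. by apply/matrixP => i j; rewrite !mxE mulrDr. Qed.
Lemma tensmxZl c X Z : (c *: X) *t Z = c *: (X *t Z).
Proof. by apply/matrixP => i j; rewrite !mxE mulrA. Qed.
Lemma tensmxZr c X Z : X *t (c *: Z) = c *: (X *t Z).
Proof. by apply/matrixP => i j; rewrite !mxE mulrCA. Qed.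
End TensorBilinear.

Section Representations.
Variable A : comUnitRingType.
Local Notation mx3 := 'M[A]_3.
Implicit Types (X Y : mx3).

Definition representation d (R : nat -> mx3 -> 'M[A]_d) : Prop :=
  (forall r c X Y, R r (c *: X + Y) = c *: R r X + R r Y) /\
  (forall r s p q X Y, sl12_mem X -> sl12_mem Y -> homogeneous p X -> homogeneous q Y ->
     R r X *m R s Y - (-1) ^+ (p && q) *: (R s Y *m R r X) = R (r + s)%N (superbracket p q X Y)).

Lemma representation_module d (R : nat -> mx3 -> 'M[A]_d) : representation R ->
  current_module (fun r X (v : 'cV[A]_d) => R r X *m v).
Proof.
move=> [hlin hbr]; split=> [r X c u v|r c X Y u _ _|r s p q X Y u hX hY pX qY].
- by rewrite mulmxDr scalemxAr.
- by rewrite hlin mulmxDl scalemxAl.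
- by rewrite -hbr // mulmxBl -scalemxAl !mulmxA.
Qed.

(* The four-dimensional module with basis [w], [y2 w], [x1 w], [y3 w], on which
   [h1 w = a w] and [h2 w = w]. *)
Definition eval_mx (a : A) X : 'M[A]_4 :=
  \matrix_(i, j) nth 0 (nth [::]
    [:: [:: X o1 o1 * a - X o3 o3; X o2 o3; X o2 o1 * a; X o1 o3 * (a - 1)];
        [:: X o3 o2; X o1 o1 * (a - 1) + X o3 o3; X o3 o1 * a; X o1 o2 * (1 - a)];
        [:: X o1 o2; X o1 o3; X o1 o1 * a; 0];
        [:: X o3 o1; - X o2 o1; 0; X o1 o1 * (a - 1)]] i) j.

Lemma odd_entries X : homogeneous true X ->
  [/\ X o1 o1 = 0, X o2 o2 = 0, X o3 o3 = 0, X o2 o3 = 0 & X o3 o2 = 0].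
Proof. by move=> hX; split; apply: hX. Qed.

Lemma even_entries X : homogeneous false X ->
  [/\ X o1 o2 = 0, X o1 o3 = 0, X o2 o1 = 0 & X o3 o1 = 0].
Proof. by move=> hX; split; apply: hX. Qed.

Lemma mulmx3E X Y i j : (X *m Y) i j = X i o1 * Y o1 j + (X i o2 * Y o2 j + X i o3 * Y o3 j).
Proof.
rewrite mxE !big_ord_recl big_ord0 addr0.
by congr (X i _ * Y _ j + (X i _ * Y _ j + X i _ * Y _ j)); apply: val_inj.
Qed.

Lemma superbracketE p q X Y i j :
  superbracket p q X Y i j = (X *m Y) i j - (-1) ^+ (p && q) * (Y *m X) i j.
Proof. by rewrite !mxE. Qed.

Lemma sl12_trace X : sl12_mem X -> X o1 o1 = X o2 o2 + X o3 o3.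
Proof. by move=> hX; apply/eqP; rewrite -subr_eq0 opprD addrA; apply/eqP. Qed.

Lemma superbracket_mem p q X Y : homogeneous p X -> homogeneous q Y ->
  sl12_mem X -> sl12_mem Y -> sl12_mem (superbracket p q X Y).
Proof.
move=> pX qY /sl12_trace tX /sl12_trace tY; rewrite /sl12_mem !superbracketE !mulmx3E.
case: p q pX qY => -[] /= pX qY.
- have [h11 h22 h33 h23 h32] := odd_entries pX; have [g11 g22 g33 g23 g32] := odd_entries qY.
  by rewrite h11 h22 h33 h23 h32 g11 g22 g33 g23 g32; ring.
- have [h11 h22 h33 h23 h32] := odd_entries pX; have [g12 g13 g21 g31] := even_entries qY.
  by rewrite h11 h22 h33 h23 h32 g12 g13 g21 g31; ring.
- have [h12 h13 h21 h31] := even_entries pX; have [g11 g22 g33 g23 g32] := odd_entries qY.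
  by rewrite h12 h13 h21 h31 g11 g22 g33 g23 g32; ring.
- have [h12 h13 h21 h31] := even_entries pX; have [g12 g13 g21 g31] := even_entries qY.
  by rewrite h12 h13 h21 h31 g12 g13 g21 g31; ring.
Qed.

Lemma eval_mx_linear a c X Y : eval_mx a (c *: X + Y) = c *: eval_mx a X + eval_mx a Y.
Proof.
by apply/matrixP => -[[|[|[|[|//]]]] ?] [[|[|[|[|//]]]] ?]; rewrite !mxE /= ?mxE; ring.
Qed.

Lemma eval_mx_bracket a p q X Y :
  sl12_mem X -> sl12_mem Y -> homogeneous p X -> homogeneous q Y ->
  eval_mx a X *m eval_mx a Y - (-1) ^+ (p && q) *: (eval_mx a Y *m eval_mx a X) =
  eval_mx a (superbracket p q X Y).
Proof.
move=> /sl12_trace tX /sl12_trace tY pX qY.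
have mul4 (P Q : 'M[A]_4) i j : (P *m Q) i j = P i (@Ordinal 4 0 isT) * Q (@Ordinal 4 0 isT) j
   + (P i (@Ordinal 4 1 isT) * Q (@Ordinal 4 1 isT) j + (P i (@Ordinal 4 2 isT) * Q (@Ordinal 4 2 isT) j
   + P i (@Ordinal 4 3 isT) * Q (@Ordinal 4 3 isT) j)).
  rewrite mxE !big_ord_recl big_ord0 addr0.
  by congr (P i _ * Q _ j + (P i _ * Q _ j + (P i _ * Q _ j + P i _ * Q _ j))); apply: val_inj.
have evE P (i j : 'I_4) : eval_mx a P i j = nth 0 (nth [::]
    [:: [:: P o1 o1 * a - P o3 o3; P o2 o3; P o2 o1 * a; P o1 o3 * (a - 1)];
        [:: P o3 o2; P o1 o1 * (a - 1) + P o3 o3; P o3 o1 * a; P o1 o2 * (1 - a)];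
        [:: P o1 o2; P o1 o3; P o1 o1 * a; 0];
        [:: P o3 o1; - P o2 o1; 0; P o1 o1 * (a - 1)]] i) j by rewrite mxE.
apply/matrixP => i j; rewrite [LHS]mxE [X in _ + X]mxE [X in _ - X]mxE !mul4 !evE !superbracketE !mulmx3E.
clear evE mul4.
case: p q pX qY => -[] /= pX qY.
- have [h11 h22 h33 h23 h32] := odd_entries pX; have [g11 g22 g33 g23 g32] := odd_entries qY.
  rewrite h11 h22 h33 h23 h32 g11 g22 g33 g23 g32; clear.
  by case: i => -[|[|[|[|//]]]] ?; case: j => -[|[|[|[|//]]]] ?; rewrite /=; ring.
- have [h11 h22 h33 h23 h32] := odd_entries pX; have [g12 g13 g21 g31] := even_entries qY.
  rewrite h11 h22 h33 h23 h32 tY g12 g13 g21 g31; clear.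
  by case: i => -[|[|[|[|//]]]] ?; case: j => -[|[|[|[|//]]]] ?; rewrite /=; ring.
- have [h12 h13 h21 h31] := even_entries pX; have [g11 g22 g33 g23 g32] := odd_entries qY.
  rewrite tX h12 h13 h21 h31 g11 g22 g33 g23 g32; clear.
  by case: i => -[|[|[|[|//]]]] ?; case: j => -[|[|[|[|//]]]] ?; rewrite /=; ring.
- have [h12 h13 h21 h31] := even_entries pX; have [g12 g13 g21 g31] := even_entries qY.
  rewrite tX tY h12 h13 h21 h31 g12 g13 g21 g31; clear.
  by case: i => -[|[|[|[|//]]]] ?; case: j => -[|[|[|[|//]]]] ?; rewrite /=; ring.
Qed.

Definition even_proj : 'M[A]_4 := \matrix_(i, j) ((i == j) && (i < 2)%N)%:R.
Definition odd_proj : 'M[A]_4 := \matrix_(i, j) ((i == j) && (2 <= i)%N)%:R.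
(** The parity automorphism, +1 on even and -1 on odd matrices. It lets the sign rule of a tensor
    product be written linearly in [X], without splitting [X] into homogeneous parts. *)
Definition parity_mx X : mx3 := \matrix_(i, j) ((-1) ^+ (ipar i (+) ipar j) * X i j).
Definition grading (p : bool) : 'M[A]_4 := even_proj + (-1) ^+ p *: odd_proj.

Lemma parity_mx_linear c X Y : parity_mx (c *: X + Y) = c *: parity_mx X + parity_mx Y.
Proof. by apply/matrixP => i j; rewrite !mxE mulrDr mulrCA. Qed.

Lemma parity_mx_homogeneous p X : homogeneous p X -> parity_mx X = (-1) ^+ p *: X.
Proof.
move=> hX; apply/matrixP => i j; rewrite !mxE.
by have [<-//|hp] := eqVneq (ipar i (+) ipar j) p; rewrite hX // !mulr0.
Qed.

Lemma mul_diag4 (d : 'I_4 -> A) (P : 'M[A]_4) i j :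
  ((\matrix_(k, l) (d k *+ (k == l))) *m P) i j = d i * P i j.
Proof.
rewrite mxE (bigD1 i) //= mxE eqxx big1 ?addr0 // => k hk.
by rewrite mxE eq_sym (negPf hk) mul0r.
Qed.

Lemma mul_diag4r (d : 'I_4 -> A) (P : 'M[A]_4) i j :
  (P *m (\matrix_(k, l) (d k *+ (k == l)))) i j = P i j * d j.
Proof.
rewrite mxE (bigD1 j) //= mxE eqxx big1 ?addr0 // => k hk.
by rewrite mxE (negPf hk) mulr0.
Qed.

Let gsign (p : bool) (i : 'I_4) : A := (-1) ^+ (p && (2 <= i)%N).

Lemma gradingE p : grading p = \matrix_(k, l) (gsign p k *+ (k == l)).
Proof.
apply/matrixP => i j; rewrite !mxE /gsign ltnNge; case: (2 <= i)%N; case: (i == j); case: p.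
all: by rewrite /= ?mulr0n ?mulr1n ?mulr0 ?mulr1 ?addr0 ?add0r ?expr0.
Qed.

Lemma grading_mul p q : grading p *m grading q = grading (p (+) q).
Proof.
apply/matrixP => i j; rewrite {1}gradingE mul_diag4 !gradingE !mxE; case: eqP => [->|_]; last by rewrite !mulr0n mulr0.
by rewrite !mulr1n /gsign -signr_addb; congr (_ ^+ _); case: p; case: q; case: (2 <= j)%N.
Qed.

Lemma eval_mx_grading a p q X : homogeneous p X ->
  eval_mx a X *m grading q = (-1) ^+ (p && q) *: (grading q *m eval_mx a X).
Proof.
move=> hX; apply/matrixP => i j.
rewrite [RHS]mxE gradingE mul_diag4 mul_diag4r mulrA mulrC.
have [hp|hp] := eqVneq ((2 <= i)%N (+) (2 <= j)%N) p.
  congr (_ * _); rewrite /gsign -signr_addb -hp.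
  by case: q; case: (2 <= i)%N; case: (2 <= j)%N.
suff -> : eval_mx a X i j = 0 by rewrite !mulr0.
rewrite mxE; case: p hX hp => hX.
- have [h11 h22 h33 h23 h32] := odd_entries hX.
  case: i => -[|[|[|[|//]]]] ?; case: j => -[|[|[|[|//]]]] ?; rewrite //= => _;
  by rewrite ?h11 ?h22 ?h33 ?h23 ?h32 ?mul0r ?subr0 ?addr0.
- have [h12 h13 h21 h31] := even_entries hX.
  case: i => -[|[|[|[|//]]]] ?; case: j => -[|[|[|[|//]]]] ?; rewrite //= => _;
  by rewrite ?h12 ?h13 ?h21 ?h31 ?mul0r ?oppr0.
Qed.

Lemma superbracket_homogeneous p q X Y : homogeneous p X -> homogeneous q Y ->
  homogeneous (p (+) q) (superbracket p q X Y).
Proof.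
move=> hX hY i j hij.
have prod (Z T : mx3) p' q' : homogeneous p' Z -> homogeneous q' T -> p' (+) q' = p (+) q ->
    (Z *m T) i j = 0.
  move=> hZ hT e; rewrite mxE big1 // => k _.
  have [e1|/hZ ->] := eqVneq (ipar i (+) ipar k) p'; last by rewrite mul0r.
  have [e2|/hT ->] := eqVneq (ipar k (+) ipar j) q'; last by rewrite mulr0.
  by move: hij; rewrite -e -e1 -e2; case: (ipar i); case: (ipar j); case: (ipar k).
rewrite superbracketE.
by rewrite (prod _ _ _ _ hX hY) // (prod _ _ _ _ hY hX) 1?addbC // mulr0 subr0.
Qed.

Variables (a z : nat -> A).

(** Recursive rather than [4 ^ n], so that the size of a Kronecker product matches by conversion. *)
Fixpoint tensor_dim (n : nat) : nat := if n is n'.+1 then (4 * tensor_dim n')%N else 1%N.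

(* Tensor product of the evaluation modules at [z 0], ..., [z n.-1]; the last factor is written
   first, and moving an odd [X] past it costs the sign carried by [odd_proj]. *)
Fixpoint tensor_rep (n : nat) (r : nat) X : 'M[A]_(tensor_dim n) :=
  if n is n'.+1 return 'M[A]_(tensor_dim n) then
    z n' ^+ r *: (eval_mx (a n') X *t 1%:M)
    + (even_proj *t tensor_rep n' r X + odd_proj *t tensor_rep n' r (parity_mx X))
  else 0.

Lemma tensor_rep_linear n r c X Y :
  tensor_rep n r (c *: X + Y) = c *: tensor_rep n r X + tensor_rep n r Y.
Proof.
elim: n X Y => [|n IH] X Y /=; first by rewrite scaler0 addr0.
by rewrite parity_mx_linear !IH eval_mx_linear; apply/matrixP => i j; rewrite !mxE; ring.
Qed.

Lemma tensor_rep_homogeneous n r p X : homogeneous p X ->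
  tensor_rep n.+1 r X = z n ^+ r *: (eval_mx (a n) X *t 1%:M) + grading p *t tensor_rep n r X.
Proof.
move=> hX /=; congr (_ + _); rewrite (parity_mx_homogeneous hX) /grading tensmxDl.
have {}zrep c : tensor_rep n r (c *: X) = c *: tensor_rep n r X.
  have h0 : tensor_rep n r 0 = 0.
    have := tensor_rep_linear n r (-1) 0 0.
    by rewrite scaler0 addr0 scaleN1r addNr.
  by have := tensor_rep_linear n r c X 0; rewrite h0 !addr0.
by rewrite zrep tensmxZl tensmxZr.
Qed.

(** The diagonal terms give the brackets on the two factors because gradings multiply. The mixed
    terms cancel because moving [eval_mx] past a grading produces exactly the sign of the
    supercommutator. *)
Lemma tensor_rep_representation n : representation (tensor_rep n).
Proof.
split=> [r c X Y|]; first exact: tensor_rep_linear.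
elim: n => [|n IH] r s p q X Y hX hY pX qY; first by rewrite /= mul0mx scaler0 subr0.
rewrite (tensor_rep_homogeneous _ _ pX) (tensor_rep_homogeneous _ _ qY).
rewrite (tensor_rep_homogeneous _ _ (superbracket_homogeneous pX qY)).
rewrite -IH // -eval_mx_bracket //.
rewrite !(mulmxDl, mulmxDr) -!(scalemxAl, scalemxAr) !tensmx_mul.
rewrite !(mul1mx, mulmx1) !grading_mul (eval_mx_grading _ _ pX) (eval_mx_grading _ _ qY).
rewrite [q (+) p]addbC [q && p]andbC.
move: (tensor_rep n r X) (tensor_rep n s Y) (grading (p (+) q)) (tensor_rep n r X *m _)
  (tensor_rep n s Y *m _) (grading q *m _) (grading p *m _) (eval_mx _ X *m _) (eval_mx _ Y *m _).
move=> S' T' G S T U' V' U V; apply/matrixP => i j; rewrite !mxE.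
by case: (p && q); rewrite /= ?expr0 ?expr1 exprD; ring.
Qed.

End Representations.

Section TensorVectors.
Variable A : comUnitRingType.
Implicit Types (X Y : 'M[A]_3).
Variables (a z : nat -> A).
Local Notation tensor_rep := (tensor_rep a z).
Local Notation even_proj := (even_proj A).
Local Notation odd_proj := (odd_proj A).

(** The Kronecker product of two columns has width [1 * 1]; this retypes it as a column. *)
Definition tensv m n (u : 'cV[A]_m) (v : 'cV[A]_n) : 'cV[A]_(m * n) := u *t v.

Lemma tensv_mul m n (P : 'M[A]_m) (Q : 'M[A]_n) u v :
  (P *t Q) *m tensv u v = tensv (P *m u) (Q *m v).
Proof. exact: (@tensmx_mul A m m n n 1 1 P Q u v). Qed.

Lemma tens0v m n (v : 'cV[A]_n) : tensv (0 : 'cV_m) v = 0.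
Proof. exact: (@tens0mx A m 1 n 1). Qed.
Lemma tensv0 m n (u : 'cV[A]_m) : tensv u (0 : 'cV_n) = 0.
Proof. exact: (@tensmx0 A m 1 n 1). Qed.
Lemma tensvDr m n (u : 'cV[A]_m) (v v' : 'cV[A]_n) : tensv u (v + v') = tensv u v + tensv u v'.
Proof. exact: (@tensmxDr A m 1 n 1). Qed.
Lemma tensvZr m n c (u : 'cV[A]_m) (v : 'cV[A]_n) : tensv u (c *: v) = c *: tensv u v.
Proof. exact: (@tensmxZr A m 1 n 1). Qed.
Lemma tensvZl m n c (u : 'cV[A]_m) (v : 'cV[A]_n) : tensv (c *: u) v = c *: tensv u v.
Proof. exact: (@tensmxZl A m 1 n 1). Qed.

Definition basis4 (i : 'I_4) : 'cV[A]_4 := delta_mx i 0.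
Definition idx_w : 'I_4 := @Ordinal 4 0 isT.
Definition idx_y2w : 'I_4 := @Ordinal 4 1 isT.
Definition idx_x1w : 'I_4 := @Ordinal 4 2 isT.
Definition idx_y3w : 'I_4 := @Ordinal 4 3 isT.

Fixpoint tensor_vec (n : nat) : 'cV[A]_(tensor_dim n) :=
  if n is n'.+1 return 'cV[A]_(tensor_dim n) then tensv (basis4 idx_w) (tensor_vec n')
  else const_mx 1.

Lemma tensor_rep_tensv n r X u v : even_proj *m u = u -> odd_proj *m u = 0 ->
  tensor_rep n.+1 r X *m tensv u v =
  z n ^+ r *: tensv (eval_mx (a n) X *m u) v + tensv u (tensor_rep n r X *m v).
Proof.
move=> h0 h1; rewrite /= !mulmxDl -scalemxAl !tensv_mul h0 h1 mul1mx.
by rewrite tens0v addr0.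
Qed.

Lemma even_proj_basis (i : 'I_4) : (i < 2)%N -> even_proj *m basis4 i = basis4 i.
Proof.
move=> hi; rewrite -colE; apply/matrixP => k l; rewrite !mxE !ord1 eqxx andbT.
by case: eqP => [->|//]; rewrite hi.
Qed.

Lemma odd_proj_basis (i : 'I_4) : (i < 2)%N -> odd_proj *m basis4 i = 0.
Proof.
move=> hi; rewrite -colE; apply/matrixP => k l; rewrite !mxE.
by case: eqP => [->|//]; rewrite leqNgt hi.
Qed.

Lemma tensor_rep_eigen n r X (c : A -> A) :
  (forall b, eval_mx b X *m basis4 idx_w = c b *: basis4 idx_w) ->
  tensor_rep n r X *m tensor_vec n = (\sum_(j < n) c (a j) * z j ^+ r) *: tensor_vec n.
Proof.
move=> hc; elim: n => [|n IH]; first by rewrite big_ord0 scale0r mul0mx.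
rewrite tensor_rep_tensv ?even_proj_basis ?odd_proj_basis // IH hc big_ord_recr scalerDl addrC.
by rewrite tensvZr tensvZl scalerA [c _ * _]mulrC.
Qed.

Local Notation E := (@delta_mx A 3 3).

Ltac eval_basis := rewrite -colE; apply/matrixP => -[[|[|[|[|//]]]] ?] ?;
  rewrite !mxE ?ord1 ?eqxx ?andbT /= ?mxE /=
    ?(mul0r, mul1r, mulr1, mulr0, subr0, addr0, sub0r, oppr0, add0r, opprK) //.

Lemma eval_Y1 b : eval_mx b (E o2 o1) *m basis4 idx_w = 0 *: basis4 idx_w.
Proof. by rewrite scale0r; eval_basis. Qed.
Lemma eval_X2 b : eval_mx b (E o2 o3) *m basis4 idx_w = 0 *: basis4 idx_w.
Proof. by rewrite scale0r; eval_basis. Qed.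
Lemma eval_X3 b : eval_mx b (E o1 o3) *m basis4 idx_w = 0 *: basis4 idx_w.
Proof. by rewrite scale0r; eval_basis. Qed.
Lemma eval_H1 b : eval_mx b (E o1 o1 + E o2 o2) *m basis4 idx_w = b *: basis4 idx_w.
Proof. by eval_basis. Qed.
Lemma eval_H2 b : eval_mx b (E o2 o2 - E o3 o3) *m basis4 idx_w = 1 *: basis4 idx_w.
Proof. by rewrite scale1r; eval_basis. Qed.
Lemma eval_Y2 b : eval_mx b (E o3 o2) *m basis4 idx_w = basis4 idx_y2w.
Proof. by eval_basis. Qed.
Lemma eval_Y2Y2 b : eval_mx b (E o3 o2) *m basis4 idx_y2w = 0.
Proof. by eval_basis. Qed.
Lemma eval_X1 b : eval_mx b (E o1 o2) *m basis4 idx_w = basis4 idx_x1w.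
Proof. by eval_basis. Qed.
Lemma eval_Y3 b : eval_mx b (E o3 o1) *m basis4 idx_w = basis4 idx_y3w.
Proof. by eval_basis. Qed.

Definition tensor_ops n : sl12_ops 'cV[A]_(tensor_dim n) :=
  ops_of (representation_module (tensor_rep_representation a z n)).

(** Binomial formula for the two commuting summands of [y2]. Since [y2] squares to 0 on [w] in the
    four-dimensional factor, only two terms remain, and each new factor raises the nilpotency order
    by at most one. *)
Lemma tensor_Y2_word n k v :
  word (Y2 (tensor_ops n.+1)) (nseq k.+1 0%N) (tensv (basis4 idx_w) v) =
  tensv (basis4 idx_w) (word (Y2 (tensor_ops n)) (nseq k.+1 0%N) v)
  + k.+1%:R *: tensv (basis4 idx_y2w) (word (Y2 (tensor_ops n)) (nseq k 0%N) v).
Proof.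
have y2E m (u : 'cV_(tensor_dim m)) : Y2 (tensor_ops m) 0%N u = tensor_rep m 0 (E o3 o2) *m u by [].
have h0 u : Y2 (tensor_ops n.+1) 0%N (tensv (basis4 idx_w) u) =
    tensv (basis4 idx_w) (Y2 (tensor_ops n) 0%N u) + tensv (basis4 idx_y2w) u.
  rewrite !y2E tensor_rep_tensv ?even_proj_basis ?odd_proj_basis // eval_Y2 expr0 scale1r.
  exact: addrC.
have h1 u : Y2 (tensor_ops n.+1) 0%N (tensv (basis4 idx_y2w) u) =
    tensv (basis4 idx_y2w) (Y2 (tensor_ops n) 0%N u).
  rewrite !y2E tensor_rep_tensv ?even_proj_basis ?odd_proj_basis // eval_Y2Y2 expr0 scale1r.
  by rewrite tens0v add0r.
elim: k => [|k IH]; first by rewrite /= h0 scale1r.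
rewrite -[LHS]/(Y2 (tensor_ops n.+1) 0%N
  (word (Y2 (tensor_ops n.+1)) (nseq k.+1 0%N) (tensv (basis4 idx_w) v))).
rewrite IH linearD linearZ h0 h1 -addrA; congr (_ + _).
rewrite -[Y2 (tensor_ops n) 0%N (word _ _ v)]/(word (Y2 (tensor_ops n)) (nseq k.+1 0%N) v).
by rewrite -[X in X + _]scale1r -scalerDl addrC natr1.
Qed.

Lemma tensor_hw n :
  hw_vector (tensor_ops n) (fun r => \sum_(j < n) a j * z j ^+ r) (fun r => \sum_(j < n) z j ^+ r)
    n (tensor_vec n).
Proof.
have z0 : \sum_(j < n) 0 * z j ^+ 0 = 0 by rewrite big1 // => j _; rewrite mul0r.
split.
- move=> r; rewrite [LHS](tensor_rep_eigen n r eval_Y1) big1 ?scale0r // => j _; exact: mul0r.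
- move=> r; rewrite [LHS](tensor_rep_eigen n r eval_X2) big1 ?scale0r // => j _; exact: mul0r.
- move=> r; rewrite [LHS](tensor_rep_eigen n r eval_X3) big1 ?scale0r // => j _; exact: mul0r.
- by move=> r; rewrite [LHS](tensor_rep_eigen n r eval_H1).
- move=> r; rewrite [LHS](tensor_rep_eigen n r eval_H2); congr (_ *: _).
  by apply: eq_bigr => j _; rewrite mul1r.
- by rewrite (eq_bigr (fun=> 1)) ?sumr_const ?card_ord.
clear z0; elim: n => [|n IH]; first exact: mul0mx.
rewrite tensor_Y2_word -[nseq n.+2 _]/([:: 0%N] ++ nseq n.+1 0%N) word_cat IH linear0.
by rewrite !tensv0 scaler0 addr0.
Qed.

End TensorVectors.

Lemma map_eval_mx (A B : comUnitRingType) (f : {rmorphism A -> B}) a (X : 'M[A]_3) :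
  map_mx f (eval_mx a X) = eval_mx (f a) (map_mx f X).
Proof.
apply/matrixP => i j; rewrite !mxE -[0 in RHS](rmorph0 f) -[[::] in RHS]/(map f [::]).
case: i => -[|[|[|[|//]]]] ?; case: j => -[|[|[|[|//]]]] ?; rewrite /= ?mxE;
by rewrite ?(rmorph0, rmorphB, rmorphD, rmorphN, rmorphM, rmorph1).
Qed.

Lemma map_tensor_rep (A B : comUnitRingType) (f : {rmorphism A -> B}) a z n r (X : 'M[A]_3) :
  map_mx f (tensor_rep a z n r X) = tensor_rep (f \o a) (f \o z) n r (map_mx f X).
Proof.
elim: n X => [|n IH] X /=; first by rewrite map_mx0.
have hp : map_mx f (parity_mx X) = parity_mx (map_mx f X).
  by apply/matrixP => i j; rewrite !mxE rmorphM rmorphXn rmorphN1.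
have he : map_mx f (even_proj A) = even_proj B.
  by apply/matrixP => i j; rewrite !mxE rmorph_nat.
have ho : map_mx f (odd_proj A) = odd_proj B.
  by apply/matrixP => i j; rewrite !mxE rmorph_nat.
by rewrite !map_mxD map_mxZ !map_mxT !IH hp he ho map_mx1 map_eval_mx rmorphXn.
Qed.

Lemma map_tensor_vec (A B : comUnitRingType) (f : {rmorphism A -> B}) n :
  map_mx f (tensor_vec A n) = tensor_vec B n.
Proof.
elim: n => [|n IH] /=; first by rewrite map_const_mx rmorph1.
rewrite -IH -[basis4 B idx_w](map_delta_mx f); apply: (@map_mxT A B f 4 1 (tensor_dim n) 1).
Qed.

(** * Cyclicity of the tensor product at distinct points *)

Section Cyclicity.
Variable K : fieldType.
Variables (a z : nat -> K).
Implicit Types (X : 'M[K]_3).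
Local Notation tensor_rep := (tensor_rep a z).

Lemma tensmx_sumr m n p q (I : finType) (P : 'M[K]_(m, n)) (F : I -> 'M[K]_(p, q)) :
  P *t (\sum_i F i) = \sum_i P *t F i.
Proof. exact: (big_morph _ (tensmxDr P) (tensmx0 P)). Qed.

(** The left side is the action of X f(t), which sees the last factor only through f(z n). *)
Lemma tensor_rep_poly n (f : {poly K}) X :
  \sum_(r < size f) f`_r *: tensor_rep n.+1 r X = f.[z n] *: (eval_mx (a n) X *t 1%:M) +
    (even_proj K *t (\sum_(r < size f) f`_r *: tensor_rep n r X)
     + odd_proj K *t (\sum_(r < size f) f`_r *: tensor_rep n r (parity_mx X))).
Proof.
rewrite horner_coef scaler_suml !tensmx_sumr -!big_split; apply: eq_bigr => r _ /=.
by rewrite !tensmxZr !scalerDr scalerA.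
Qed.

Lemma tensor_rep_vanish n (f : {poly K}) X : (forall j, (j < n)%N -> f.[z j] = 0) ->
  \sum_(r < size f) f`_r *: tensor_rep n r X = 0.
Proof.
elim: n X => [|n IH] X hf; first by rewrite big1 // => r _; rewrite scaler0.
rewrite tensor_rep_poly !IH ?hf ?scale0r ?tensmx0 ?addr0 // => j hj; apply: hf; exact: ltnW.
Qed.

Lemma tensv_decomp n (v : 'cV[K]_(4 * n)) :
  v = \sum_i tensv (basis4 K i) (\col_k v (mxtens_index (i, k)) 0).
Proof.
apply/matrixP => k l; rewrite summxE [l]ord1; case: (mxtens_indexP k) => i j.
rewrite (bigD1 i) //= big1 => [|i' hi'].
  by rewrite !mxE mxtens_indexK /= !ord1 !eqxx mul1r addr0.
by rewrite !mxE mxtens_indexK /= eq_sym (negPf hi') mul0r.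
Qed.

(* At distinct points a polynomial in [t] isolates each tensor factor. *)
Lemma tensor_cyclic n (S : 'cV[K]_(tensor_dim n) -> Prop) :
  (forall i j, (i < n)%N -> (j < n)%N -> z i = z j -> i = j) ->
  submod S -> S (tensor_vec K n) ->
  (forall r X v, sl12_mem X -> S v -> S (tensor_rep n r X *m v)) -> forall v, S v.
Proof.
elim: n S => [|n IH] S hz hS hw hR v.
  have -> : v = v 0 0 *: tensor_vec K 0.
    by apply/matrixP => i j; rewrite !mxE !ord1 mulr1.
  exact: submodZ.
pose f := \prod_(j < n) ('X - (z j)%:P).
have fz j : (j < n)%N -> f.[z j] = 0.
  by move=> hj; rewrite horner_prod (bigD1 (Ordinal hj)) //= hornerXsubC subrr mul0r.
have fn : f.[z n] != 0.
  rewrite horner_prod; apply/prodf_neq0 => j _; rewrite hornerXsubC subr_eq0.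
  apply/eqP => /(hz n j (ltnSn n) (ltnW (ltn_ord j))) e.
  by have := ltn_ord j; rewrite -e ltnn.
have hlast X u : sl12_mem X -> S u -> S ((eval_mx (a n) X *t 1%:M) *m u).
  move=> hX hu.
  have : S ((\sum_(r < size f) f`_r *: tensor_rep n.+1 r X) *m u).
    rewrite mulmx_suml; apply: submod_sum => // r _; rewrite -scalemxAl.
    by apply: submodZ => //; apply: hR.
  rewrite tensor_rep_poly !tensor_rep_vanish // !tensmx0 !addr0 -scalemxAl.
  by move/(submodZ (f.[z n])^-1 hS); rewrite scalerA mulVf // scale1r.
(* Subtracting the action on the last factor, available by [hlast], leaves the action on the first
   [n] points. Induction then applies with the last factor frozen at its highest weight vector. *)
have hfirst u : S (tensv (basis4 K (idx_w)) u).
  apply: (IH (fun u => S (tensv (basis4 K idx_w) u))) => //.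
  - by move=> i j hi hj; apply: hz; apply: ltnW.
  - split=> [|u1 u2 h1 h2|c u1 h1]; first by rewrite tensv0; apply: submod0.
      by rewrite tensvDr; apply: submodD.
    by rewrite tensvZr; apply: submodZ.
  - move=> r X u' hX hu'.
    have := tensor_rep_tensv a z (n := n) r X u' (even_proj_basis K (i := idx_w) isT) (odd_proj_basis K (i := idx_w) isT).
    rewrite addrC => /eqP; rewrite -subr_eq => /eqP <-.
    apply: submodB => //; first exact: hR.
    apply: submodZ => //; have := hlast X _ hX hu'; rewrite tensv_mul mul1mx; exact.
have hi i u : S (tensv (basis4 K i) u).
  have go (c d : 'I_3) j : c != d -> eval_mx (a n) (delta_mx c d) *m basis4 K idx_w = basis4 K j ->
      S (tensv (basis4 K j) u).
    move=> hcd <-; have := hlast _ _ (sl12_mem_delta K hcd) (hfirst u).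
    by rewrite tensv_mul mul1mx.
  case: i => -[|[|[|[|//]]]] hi.
  - by rewrite (_ : Ordinal hi = idx_w); [exact: hfirst|exact: val_inj].
  - by rewrite (_ : Ordinal hi = idx_y2w); [apply: go (eval_Y2 _)|exact: val_inj].
  - by rewrite (_ : Ordinal hi = idx_x1w); [apply: go (eval_X1 _)|exact: val_inj].
  - by rewrite (_ : Ordinal hi = idx_y3w); [apply: go (eval_Y3 _)|exact: val_inj].
by rewrite [v]tensv_decomp; apply: submod_sum.
Qed.

End Cyclicity.

(** * The degeneration and the basis theorem *)

Lemma tensor_dimE n : tensor_dim n = (4 ^ n)%N.
Proof. by elim: n => //= n ->; rewrite expnS. Qed.

Lemma invertible_nats_poly (K : fieldType) : invertible_nats K -> invertible_nats {poly K}.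
Proof. by move=> hK m; rewrite -polyC_natr rmorph_unit. Qed.

Section Folds.
Variable n : nat.
Local Notation pops := ('M[bool]_(2, n) * (nat * seq nat))%type.

(** Kept generic in [T] so that one naturality statement transports super POP vectors along module
    maps, evaluation of 'X, and passage to coordinates. *)
Definition superPOP_fold (T : Type) (gx gy gz : nat -> T -> T) (w : T) (P : pops) : T :=
  foldr gy (foldr gx (foldr gz w (row_exps P.1 y3_row)) (row_exps P.1 x1_row))
    (even_exps (n - sA P.1) P.2).

Lemma superPOP_fold_morph (T T' : Type) (h : T -> T') gx gy gz gx' gy' gz' w P :
  (forall k v, h (gx k v) = gx' k (h v)) -> (forall k v, h (gy k v) = gy' k (h v)) ->
  (forall k v, h (gz k v) = gz' k (h v)) ->
  h (superPOP_fold gx gy gz w P) = superPOP_fold gx' gy' gz' (h w) P.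
Proof.
have hf (g : nat -> T -> T) g' v r : (forall k u, h (g k u) = g' k (h u)) ->
    h (foldr g v r) = foldr g' (h v) r by move=> hg; elim: r => //= k r <-.
by move=> hx hy hz; rewrite /superPOP_fold !(hf _ _ _ _ hx, hf _ _ _ _ hy, hf _ _ _ _ hz).
Qed.

Lemma superPOP_vecE (K : fieldType) (M : lmodType K) (act : nat -> 'M[K]_3 -> M -> M) w P :
  superPOP_vec act w P =
  superPOP_fold (fun k => act k (x1 K)) (fun k => act k (y2 K)) (fun k => act k (y3 K)) w P.
Proof.
rewrite /superPOP_vec /act_word !foldr_cat.
have fold_map X r v : foldr (fun b u => act b.2 b.1 u) v [seq (X, k) | k <- r] =
    foldr (fun k => act k X) v r by elim: r => //= k r ->.
have -> : nseq (n - sA P.1 - P.2.1 - size P.2.2) (y2 K, 0%N) =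
    [seq (y2 K, k) | k <- nseq (n - sA P.1 - P.2.1 - size P.2.2) 0%N] by rewrite map_nseq.
have -> : flatten [seq nseq (count_mem k P.2.2) (y2 K, k) | k <- iota 1 (P.2.1 - 0)] =
    [seq (y2 K, k) | k <- flatten [seq nseq (count_mem k P.2.2) k | k <- iota 1 P.2.1]].
  rewrite subn0 map_flatten -map_comp; congr flatten; apply: eq_map => k /=.
  by rewrite map_nseq.
rewrite /superPOP_fold /even_exps foldr_cat -!fold_map; do 3 congr foldr.
  congr foldr; rewrite /row_exps -map_comp; exact: eq_map.
rewrite /row_exps -map_comp; exact: eq_map.
Qed.

End Folds.

(** * The spanning statement for cyclic g[t]-modules *)

Section GtModules.
Variables (K : fieldType) (M : lmodType K) (act : nat -> 'M[K]_3 -> M -> M).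
Hypothesis K_nat : invertible_nats K.
Hypothesis actM : is_gt_module act.

Lemma gt_module_current : current_module act.
Proof.
case: actM => h1 h2 h3; split=> [//|r c X Y u /eqP hX /eqP hY|]; first exact: h2.
by move=> r s p q X Y u /eqP hX /eqP hY pX qY; apply: h3.
Qed.

Variables (psi : 'I_2 -> nat -> K) (n : nat) (w : M).
Hypothesis psi_n : psi k2 0%N = n%:R.
Hypothesis wW : W_rel psi n act w.

Let o := ops_of gt_module_current.

Lemma W_rel_hw : hw_vector o (psi k1) (psi k2) n w.
Proof.
case: wW => h1 h2 h3 h4 h5; split=> //; first exact: (h4 k1); first exact: (h4 k2).
by rewrite -[RHS]h5; elim: (n.+1) => //= m <-.
Qed.

Lemma generated_monomial_span u : generated act w u -> monomial_span o w u.
Proof.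
elim=> {u}[|u v _ hu _ hv|c u _ hu|r X u /eqP hX _ hu].
- exact: monomial_span_w.
- exact: lin_span_add.
- exact: lin_span_scale.
- exact: (hw_monomial_span_closed K_nat W_rel_hw).
Qed.

Lemma generated_superPOP_span u : generated act w u ->
  exists (ps : seq ('M[bool]_(2, n) * (nat * seq nat))) c,
    all (superPOP (n:=n)) ps /\ u = \sum_(p <- ps) c p *: superPOP_vec act w p.
Proof.
have [dec hdec] := superPOP_enum n.
pose L := undup [seq P <- codom dec | superPOP P].
have hL P : superPOP P -> P \in L.
  by move=> hP; rewrite mem_undup mem_filter hP; have [i <-] := hdec P hP; apply: codom_f.
move/generated_monomial_span => hu.
suff [c ->] : exists c, u = \sum_(p <- L) c p *: superPOP_vec act w p.
  by exists L, c; split=> //; apply/allP => P; rewrite mem_undup mem_filter => /andP[].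
move: u hu; apply: (monomial_span_superPOP K_nat (ops_of_rel _) W_rel_hw).
  split=> [|u v [c ->] [e ->]|b u [c ->]].
  - by exists (fun=> 0); rewrite big1 // => p _; rewrite scale0r.
  - exists (fun p => c p + e p); rewrite -big_split; apply: eq_bigr => p _.
    by rewrite scalerDl.
  - by exists (fun p => b * c p); rewrite scaler_sumr; apply: eq_bigr => p _; rewrite scalerA.
move=> P hP; exists (fun p => (p == P)%:R); rewrite (bigD1_seq P) ?hL ?undup_uniq //=.
rewrite eqxx scale1r big1 ?addr0 => [|p /negPf ->]; last by rewrite scale0r.
by rewrite superPOP_vecE.
Qed.

End GtModules.

Lemma tensor_span_closed (A : comUnitRingType) (a z : nat -> A) n : invertible_nats A ->
  forall r X u, sl12_mem X -> monomial_span (tensor_ops a z n) (tensor_vec A n) u ->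
  monomial_span (tensor_ops a z n) (tensor_vec A n) (tensor_rep a z n r X *m u).
Proof.
move=> hA; exact: (hw_monomial_span_closed
  (actM := representation_module (tensor_rep_representation a z n)) hA (tensor_hw a z n)).
Qed.

(** * The lattice over K['X] and its reduction at 'X = 0 *)

Section Degeneration.
Variables (K : fieldType) (n : nat) (alpha zeta : nat -> K).
Hypothesis K_nat : invertible_nats K.
Local Notation pops := ('M[bool]_(2, n) * (nat * seq nat))%type.
Local Notation A := {poly K}.
Local Notation d := (tensor_dim n).
Local Notation E := (@delta_mx A 3 3).

(* The points move from [zeta j] at ['X = 0] to [j] at ['X = 1]. *)
Let a j : A := (alpha j)%:P.
Let z j : A := (zeta j)%:P + 'X * (j%:R - zeta j)%:P.
Let R := tensor_rep a z n.
Let w := tensor_vec A n.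
Let o := tensor_ops a z n.
Let A_nat := invertible_nats_poly K_nat.
Let oR : sl12_rel o := ops_of_rel _.
Let hw := tensor_hw a z n.

Let fold_R (P : pops) : 'cV[A]_d := superPOP_fold (fun k v => R k (E o1 o2) *m v)
  (fun k v => R k (E o3 o2) *m v) (fun k v => R k (E o3 o1) *m v) w P.

(** Makes the points [j] reached at 'X = 1 pairwise distinct. *)
Lemma natr_inj i j : (i%:R : K) = j%:R -> i = j.
Proof.
wlog le_ij : i j / (i <= j)%N.
  by move=> h e; case: (leqP i j) => [/h|/ltnW /h]; [exact|move/(_ (esym e))].
move=> e; apply/eqP; rewrite eqn_leq le_ij /= leqNgt; apply/negP => lt_ij.
have := K_nat (j - i).-1; rewrite prednK ?subn_gt0 // natrB // e subrr unitr0.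
by [].
Qed.

Variable dec : 'I_d -> pops.
Hypothesis dec_surj : forall P, superPOP P -> exists i, dec i = P.

(** Square because the bound on the number of super POPs equals the dimension. [dec] is only assumed
    to reach every super POP. *)
Let D : 'M[A]_d := \matrix_(k, i) fold_R (dec i) k 0.

Lemma mul_basis (B : pzRingType) m (Q : 'M[B]_m) i k : (Q *m (delta_mx i 0 : 'cV_m)) k 0 = Q k i.
Proof. by rewrite -colE mxE. Qed.

Lemma D_basis i : D *m delta_mx i 0 = fold_R (dec i).
Proof. by apply/matrixP => k l; rewrite [l]ord1 mul_basis mxE. Qed.

Lemma D_span u : monomial_span o w u -> exists c : 'cV[A]_d, u = D *m c.
Proof.
move: u; apply: (monomial_span_superPOP A_nat oR hw).
  split=> [|u v [c ->] [e ->]|b u [c ->]].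
  - by exists 0; rewrite mulmx0.
  - by exists (c + e); rewrite mulmxDr.
  - by exists (b *: c); rewrite scalemxAr.
by move=> P /dec_surj [i <-]; exists (delta_mx i 0); rewrite D_basis.
Qed.

Lemma fold_R_span P : monomial_span o w (fold_R P).
Proof. by apply: lin_span_base; do 3 eexists; reflexivity. Qed.

(** Here spanning over K['X] itself is essential: over the fraction field [C] could acquire a pole
    at 'X = 0. *)
Lemma D_stable r X : sl12_mem X -> exists C, R r X *m D = D *m C.
Proof.
move=> hX; have hcol i : exists c : 'cV[A]_d, R r X *m fold_R (dec i) = D *m c.
  by apply: D_span; apply: (tensor_span_closed A_nat) => //; apply: fold_R_span.
have [c hc] := fin_all_exists hcol.
exists (\matrix_(k, i) c i k 0); apply/matrixP => k i.
rewrite -!mul_basis -!mulmxA D_basis hc; congr ((D *m _) k 0).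
by apply/matrixP => k' l; rewrite [l]ord1 mul_basis mxE.
Qed.

Let ev (c : K) : {rmorphism A -> K} := horner_eval c.

(* At ['X = 1] the points are distinct, so the columns of [D] span the module. *)
Lemma det_D_neq0 : \det D != 0.
Proof.
suff : \det (map_mx (ev 1) D) != 0 by rewrite det_map_mx; apply: contraNneq => ->; rewrite rmorph0.
pose a' j := ev 1 (a j); pose z' j := ev 1 (z j).
have z'E j : z' j = j%:R.
  by rewrite /z' /ev /= /horner_eval !(hornerD, hornerM, hornerX, hornerC) mul1r addrC subrK.
pose D' := map_mx (ev 1) D.
have hw' := tensor_hw a' z' n.
have D'_col P : map_mx (ev 1) (fold_R P) =
    superPOP_monomial (tensor_ops a' z' n) (tensor_vec K n) P.
  rewrite -(map_tensor_vec (ev 1)) /fold_R.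
  by apply: superPOP_fold_morph => k v; rewrite map_mxM map_tensor_rep map_delta_mx.
have D'_basis i : D' *m delta_mx i 0 = map_mx (ev 1) (fold_R (dec i)).
  by rewrite -D_basis map_mxM map_delta_mx.
have lin_span' v : monomial_span (tensor_ops a' z' n) (tensor_vec K n) v.
  apply: (tensor_cyclic (a := a') (z := z')
    (S := monomial_span (tensor_ops a' z' n) (tensor_vec K n))).
  - by move=> i j _ _; rewrite !z'E; apply: natr_inj.
  - exact: lin_span_submod.
  - exact: monomial_span_w.
  - by move=> r X v' hX; apply: tensor_span_closed.
have D'_span v : exists c : 'cV[K]_d, v = D' *m c.
  move: v (lin_span' v); apply: (monomial_span_superPOP K_nat (ops_of_rel _) hw').
    split=> [|u u' [c ->] [e ->]|b u [c ->]].
    - by exists 0; rewrite mulmx0.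
    - by exists (c + e); rewrite mulmxDr.
    - by exists (b *: c); rewrite scalemxAr.
  by move=> P /dec_surj [i <-]; exists (delta_mx i 0); rewrite D'_basis D'_col.
have [c hc] := fin_all_exists (fun i : 'I_d => D'_span (delta_mx i 0)).
have : D' *m (\matrix_(k, i) c i k 0) = 1%:M.
  apply/matrixP => k i; rewrite -!mul_basis mul1mx [in RHS](hc i) -!mulmxA; congr ((D' *m _) k 0).
  by apply/matrixP => k' l; rewrite [l]ord1 mul_basis mxE.
by case/mulmx1_unit; rewrite unitmxE unitfE.
Qed.

(** Multiplying by the adjugate turns [D] into its determinant, which is nonzero in a domain. *)
Lemma D_inj m (U V : 'M[A]_(d, m)) : D *m U = D *m V -> U = V.
Proof.
move=> /(congr1 (mulmx (\adj D))); rewrite !mulmxA mul_adj_mx !mul_scalar_mx => h.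
apply/matrixP => i j; apply: (mulfI det_D_neq0).
by move/matrixP/(_ i j): h; rewrite !mxE.
Qed.

Let emb (X : 'M[K]_3) : 'M[A]_3 := map_mx polyC X.

Lemma emb_mem X : sl12_mem X -> sl12_mem (emb X).
Proof. by rewrite /sl12_mem !mxE -!polyCB => ->. Qed.

Lemma emb_homogeneous p X : homogeneous p X -> homogeneous p (emb X).
Proof. by move=> hX i j hij; rewrite mxE hX. Qed.

Lemma emb_superbracket p q X Y : emb (superbracket p q X Y) = superbracket p q (emb X) (emb Y).
Proof. by rewrite /emb /superbracket map_mxB map_mxZ !map_mxM rmorphXn rmorphN1. Qed.

(** The matrices [C] are the action in lattice coordinates. Each required identity is checked after
    multiplication by [D], where it holds for [R], then cancelled by [D_inj] and evaluated at 0. *)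
Lemma degenerate_module (psi : 'I_2 -> nat -> K) :
  (forall r, psi k1 r = \sum_(j < n) alpha j * zeta j ^+ r) ->
  (forall r, psi k2 r = \sum_(j < n) zeta j ^+ r) ->
  exists (act : nat -> 'M[K]_3 -> 'cV[K]_d -> 'cV[K]_d) (v : 'cV[K]_d),
    [/\ is_gt_module act, W_rel psi n act v &
      forall i, superPOP_vec act v (dec i) = delta_mx i 0].
Proof.
move=> psi1E psi2E.
have /boolp.choice [C hC] (rX : nat * 'M[K]_3) :
    exists C, sl12_mem rX.2 -> R rX.1 (emb rX.2) *m D = D *m C.
  case: rX => r X /=; case: (pselect (sl12_mem X)) => hX; last by exists 0.
  by have [C hC] := D_stable r (emb_mem hX); exists C.
have DC r X (u : 'cV[A]_d) : sl12_mem X -> D *m (C (r, X) *m u) = R r (emb X) *m (D *m u).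
  by move=> hX; rewrite !mulmxA -(hC (r, X)).
(* Coordinates of [w]: the zero matrix with middle entry n and empty partition is a super POP whose
   monomial is 1. *)
have [iw hiw] : exists i, fold_R (dec i) = w.
  have [|i hi] := @dec_surj (const_mx false, (n, [::])).
    rewrite /superPOP /isPOP /sA big1 /= => [|i _]; last by rewrite big1 // => j _; rewrite mxE.
    by rewrite !subn0 leqnn !andbT; apply/forallP => j; rewrite mxE implybT.
  exists i; rewrite hi /fold_R /superPOP_fold /=.
  have row0 k : row_exps (const_mx false : 'M[bool]_(2, n)) k = [::].
    by rewrite /row_exps (eq_filter (a2 := pred0)) ?filter_pred0 // => j; rewrite /= mxE.
  rewrite !row0 /= /even_exps /sA big1 => [|k _]; last by rewrite big1 // => j _; rewrite mxE.
  rewrite /= !subn0 subnn /=; suff -> : flatten [seq [::] | _ <- iota 1 n] = [::] :> seq nat by [].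
  by elim: (iota 1 n).
pose act r X (v : 'cV[K]_d) := map_mx (ev 0) (C (r, X)) *m v.
have act_map r X v : map_mx (ev 0) (C (r, X) *m v) = act r X (map_mx (ev 0) v).
  by rewrite map_mxM.
have ev0C c : ev 0 c%:P = c by rewrite /ev /= /horner_eval hornerC.
have hemb c e : emb (delta_mx c e) = delta_mx c e by rewrite /emb map_delta_mx.
exists act, (map_mx (ev 0) (delta_mx iw 0)); split.
- split=> [r X c u v|r c X Y u /eqP hX /eqP hY|r s p q X Y u /eqP hX /eqP hY pX qY].
  + by rewrite /act mulmxDr scalemxAr.
  + rewrite /act; have -> : C (r, c *: X + Y) = c%:P *: C (r, X) + C (r, Y).
      apply: D_inj; rewrite mulmxDr -scalemxAr -!hC //=; last exact/sl12_memD/hY/sl12_memZ.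
      by rewrite /emb map_mxD map_mxZ /R tensor_rep_linear mulmxDl scalemxAl.
    by rewrite map_mxD map_mxZ ev0C mulmxDl scalemxAl.
  + have -> : sbr p q X Y = superbracket p q X Y by [].
    rewrite /act.
    have -> : C ((r + s)%N, superbracket p q X Y) =
        C (r, X) *m C (s, Y) - (-1) ^+ (p && q) *: (C (s, Y) *m C (r, X)).
      apply: D_inj; rewrite -hC /=; last exact: superbracket_mem.
      have [_ hbr] : representation R := tensor_rep_representation a z n.
      rewrite emb_superbracket -hbr; try exact: emb_mem; try exact: emb_homogeneous.
      rewrite mulmxBl mulmxBr -scalemxAl -scalemxAr -!mulmxA (hC (s, Y)) // (hC (r, X)) //.
      by rewrite !mulmxA (hC (s, Y)) // (hC (r, X)).
    rewrite map_mxB map_mxZ !map_mxM rmorphXn rmorphN1 mulmxBl -scalemxAl !mulmxA.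
    by [].
- have eig r X c : sl12_mem X -> R r (emb X) *m w = c *: w ->
      act r X (map_mx (ev 0) (delta_mx iw 0)) = ev 0 c *: map_mx (ev 0) (delta_mx iw 0).
    move=> hX hc; rewrite -act_map -map_mxZ; congr map_mx; apply: D_inj.
    by rewrite DC // -scalemxAr D_basis hiw.
  have ev0z j : ev 0 (z j) = zeta j.
    by rewrite /z /ev /= /horner_eval !(hornerD, hornerM, hornerX, hornerC) mul0r addr0.
  split=> [r|r|r|k r|].
  + by rewrite (eig _ _ 0) ?rmorph0 ?scale0r //; [exact: sl12_mem_delta|rewrite hemb; exact: (hw_Y1 hw)].
  + by rewrite (eig _ _ 0) ?rmorph0 ?scale0r //; [exact: sl12_mem_delta|rewrite hemb; exact: (hw_X2 hw)].
  + by rewrite (eig _ _ 0) ?rmorph0 ?scale0r //; [exact: sl12_mem_delta|rewrite hemb; exact: (hw_X3 hw)].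
  + rewrite /hb; case: eqP => [->|hk].
      rewrite (eig _ _ (\sum_(j < n) a j * z j ^+ r)).
      * rewrite psi1E rmorph_sum; congr (_ *: _); apply: eq_bigr => j _.
        by rewrite rmorphM rmorphXn ev0z ev0C.
      * by rewrite /sl12_mem !mxE /=; ring.
      * by rewrite /emb map_mxD !map_delta_mx; exact: (hw_H1 hw).
    have -> : k = k2 by case: k hk => -[|[|//]] hk hk'; [case: hk'|]; exact: val_inj.
    rewrite (eig _ _ (\sum_(j < n) z j ^+ r)).
    * rewrite psi2E rmorph_sum; congr (_ *: _); apply: eq_bigr => j _.
      by rewrite rmorphXn ev0z.
    * by rewrite /sl12_mem !mxE /=; ring.
    * by rewrite /emb map_mxB !map_delta_mx; exact: (hw_H2 hw).
  + have it m : iter m (act 0%N (y2 K)) (map_mx (ev 0) (delta_mx iw 0)) =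
        map_mx (ev 0) (iter m (fun v => C (0%N, y2 K) *m v) (delta_mx iw 0)).
      by elim: m => //= m ->; rewrite act_map.
    have Dit m : D *m iter m (fun v => C (0%N, y2 K) *m v) (delta_mx iw 0) =
        word (Y2 o) (nseq m 0%N) w.
      elim: m => [|m IH] /=; first by rewrite D_basis.
      by rewrite DC ?IH ?hemb //; apply: sl12_mem_delta.
    rewrite it (_ : iter _ _ _ = 0) ?map_mx0 //; apply: D_inj.
    by rewrite Dit mulmx0; exact: (hw_Y2 hw).
(* In lattice coordinates the vector of [dec i] is the i-th standard basis vector, since its image
   under [D] is column i. Evaluation at 0 preserves this. *)
- move=> i; rewrite superPOP_vecE.
  pose gC X k (v : 'cV[A]_d) := C (k, X) *m v.
  rewrite -(superPOP_fold_morph (h := map_mx (ev 0)) (gx := gC (x1 K)) (gy := gC (y2 K)) (gz := gC (y3 K))).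
  + rewrite -[RHS](map_delta_mx (ev 0)); congr map_mx; apply: D_inj.
    rewrite D_basis (superPOP_fold_morph (h := mulmx D) (gx' := fun k v => R k (E o1 o2) *m v)
      (gy' := fun k v => R k (E o3 o2) *m v) (gz' := fun k v => R k (E o3 o1) *m v)).
    * by rewrite D_basis hiw.
    * by move=> k v; rewrite /gC DC ?hemb //; apply: sl12_mem_delta.
    * by move=> k v; rewrite /gC DC ?hemb //; apply: sl12_mem_delta.
    * by move=> k v; rewrite /gC DC ?hemb //; apply: sl12_mem_delta.
  all: by move=> k v; apply: act_map.
Qed.

End Degeneration.

Import Num.Theory.

Lemma invertible_nats_num (K : numFieldType) : invertible_nats K.
Proof. by move=> m; rewrite unitfE pnatr_eq0. Qed.

(* A point with multiplicity [k] is split into [k] points, each carrying [1/k] of the weight. *)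
Lemma weight_split (K : numFieldType) (psi : 'I_2 -> nat -> K) (s : nat)
    (mu : 'I_s -> 'I_2 -> K) (z : 'I_s -> K) n :
  (forall j, in_Pplus (mu j)) ->
  (forall k p, psi k p = \sum_(j < s) z j ^+ p * mu j k) -> psi k2 0%N = n%:R ->
  exists alpha zeta : nat -> K,
    (forall r, psi k1 r = \sum_(j < n) alpha j * zeta j ^+ r) /\
    (forall r, psi k2 r = \sum_(j < n) zeta j ^+ r).
Proof.
move=> hmu hpsi hn.
(* A point of multiplicity 0 receives no copies, so its weight on [h1] must vanish as well;
   [in_Pplus] guarantees this. *)
have [m hm] : exists m : 'I_s -> nat, forall j, mu j k2 = (m j)%:R /\ (m j = 0%N -> mu j k1 = 0).
  apply: (fin_all_exists (P := fun j m => mu j k2 = m%:R /\ (m = 0%N -> mu j k1 = 0))) => j.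
  have [[k [k0 hk]]|[h1 h2]] := hmu j; last by exists 0%N.
  by exists k; split=> // e; rewrite e in k0.
have sum_m : (\sum_j m j)%N = n.
  apply/eqP; rewrite -(eqr_nat K) -hn hpsi natr_sum; apply/eqP; apply: eq_bigr => j _.
  by rewrite expr0 mul1r (hm j).1.
pose l := flatten [seq nseq (m j) (mu j k1 / (m j)%:R, z j) | j <- enum 'I_s].
have sum_l (F : K * K -> K) :
    \sum_(i < n) F (nth (0, 0) l i) = \sum_j F (mu j k1 / (m j)%:R, z j) *+ m j.
  have size_l : size l = n.
    rewrite size_flatten /shape -map_comp sumnE big_map big_enum /= -[RHS]sum_m.
    by apply: eq_bigr => j _; rewrite size_nseq.
  rewrite -(big_mkord xpredT (fun i => F (nth (0, 0) l i))) -{1}size_l.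
  rewrite -(big_nth (0, 0) xpredT F).
  rewrite big_flatten big_map big_enum /=; apply: eq_bigr => j _.
  by rewrite big_nseq; move: (F _) => t; elim: (m j) => //= k ->; rewrite mulrS.
exists (fun i => (nth (0, 0) l i).1), (fun i => (nth (0, 0) l i).2); split=> r.
  rewrite (sum_l (fun x => x.1 * x.2 ^+ r)) hpsi; apply: eq_bigr => j _ /=.
  have [m0|m0] := eqVneq (m j) 0%N; first by rewrite m0 (hm j).2 // mulr0.
  by rewrite -mulrnAl -[_ / _ *+ _]mulr_natr divfK ?pnatr_eq0 // mulrC.
rewrite (sum_l (fun x => x.2 ^+ r)) hpsi; apply: eq_bigr => j _ /=.
by rewrite (hm j).1 mulr_natr.
Qed.

Theorem mainTheorem2 (R : realType) (psi : 'I_2 -> nat -> R[i])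
    (s : nat) (mu : 'I_s -> 'I_2 -> R[i]) (z : 'I_s -> R[i]) (n : nat) :
  (forall j, in_Pplus (mu j)) ->
  injective z ->
  (forall (k : 'I_2) (p : nat), psi k p = \sum_(j < s) z j ^+ p * mu j k) ->
  psi k2 0%N = n%:R ->
  forall (M : lmodType R[i]) (act : nat -> 'M[R[i]]_3 -> M -> M) (w : M),
    is_W psi n act w ->
    is_basis_family (superPOP (n:=n)) (superPOP_vec act w).
Proof.
move=> hmu _ hpsi hn M act w [actM wW wgen univ].
have K_nat := @invertible_nats_num R[i].
split=> [u|ps c uniq_ps all_ps sum0 p hp].
  exact: (generated_superPOP_span K_nat actM hn wW (wgen u)).
have [alpha [zeta [psi1E psi2E]]] := weight_split hmu hpsi hn.
have [dec hdec] : exists dec : 'I_(tensor_dim n) -> 'M[bool]_(2, n) * (nat * seq nat),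
    forall P, superPOP P -> exists i, dec i = P.
  by rewrite tensor_dimE; apply: superPOP_enum.
have [actN [v [actN_mod vW vecN]]] := degenerate_module K_nat hdec psi1E psi2E.
(* The universal property carries a relation between super POP vectors of [M] to one between
   standard basis vectors. *)
have [f [[f_lin f_act] fw]] := univ _ _ _ actN_mod vW.
have f_vec P : f (superPOP_vec act w P) = superPOP_vec actN v P.
  have mem (x : 'M[R[i]]_3) : sl12_mem x -> in_g x by move/eqP.
  rewrite !superPOP_vecE -fw; apply: superPOP_fold_morph => k u; apply: f_act; apply: mem;
  by rewrite /sl12_mem !mxE /=; ring.
have f_sum : \sum_(q <- ps) c q *: superPOP_vec actN v q = 0.
  have f0 : f 0 = 0 by have := f_lin (-1) 0 0; rewrite scaler0 addr0 scaleN1r addNr.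
  transitivity (f (\sum_(q <- ps) c q *: superPOP_vec act w q)); last by rewrite sum0 f0.
  elim: (ps) => [|q qs IH]; first by rewrite !big_nil f0.
  by rewrite !big_cons f_lin -IH f_vec.
have [i hi] := hdec p (allP all_ps p hp).
(* Coordinate [i] isolates [c p]: any other [q] in the list is [dec j] with j different from i. *)
move/matrixP/(_ i 0): f_sum; rewrite summxE (bigD1_seq p) //= big1_seq => [|q /andP[qp hq]].
  by rewrite -hi vecN !mxE !eqxx mulr1 addr0 hi.
have [j hj] := hdec q (allP all_ps q hq).
rewrite -hj vecN !mxE; case: eqP => [e|_]; last by rewrite mulr0.
by move: qp; rewrite -hi -hj e eqxx.
Qed.
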